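(* Let $M$ be a triangulated, compact, orientable 3-manifold, and let $S$ be a closed, connected, orientable normal surface in $M$. If the triangulation of $M$ is simplicial, then $$6\,g(S)\ \le\ 7\,q(S),$$ where $g(S)$ is the genus of $S$ and $q(S)$ is the number of quadrilateral discs in the normal cell structure of $S$.
   Context: A triangulation of $M$ consists of a finite disjoint union of 3-simplices together with face pairings whose quotient is $M$, where the quotient map is injective on the interior of each simplex of each dimension; it is simplicial if the resulting decomposition of $M$ is a simplicial complex. A normal surface in $M$ is a properly embedded surface that meets each tetrahedron in a finite disjoint collection of normal triangles (each separating one vertex of the tetrahedron from the other three) and normal quadrilaterals (each separating two vertices from the other two); $q(S)$ is the total number of quadrilaterals. *)

(* Defs.v *)
From mathcomp Require Import all_boot all_order all_algebra.
From mathcomp Require Import all_classical all_reals all_analysis.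
Set Implicit Arguments.
Unset Strict Implicit.
Unset Printing Implicit Defensive.
Import Order.TTheory GRing.Theory Num.Theory numFieldNormedType.Exports.
Local Open Scope ring_scope.

(* A simplicial triangulation is a finite abstract simplicial complex K on the
   vertex set 'I_n, and the triangulated space M is its geometric realization
   in R^n.  Simplices are their vertex sets, so a k-simplex has k + 1
   elements. *)

Definition simplicial_complex n (K : {set {set 'I_n}}) : Prop :=
  finset.set0 \notin K /\
  forall s r : {set 'I_n}, s \in K -> r \subset s -> r != finset.set0 -> r \in K.

Definition tetrahedra n (K : {set {set 'I_n}}) : {set {set 'I_n}} :=
  [set s in K | #|s| == 4%N].

Definition share_face_around n (K : {set {set 'I_n}}) (r : {set 'I_n}) :
    rel {set 'I_n} :=
  fun s t => [&& s \in tetrahedra K, t \in tetrahedra K,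
                 r \subset s :&: t & #|s :&: t| == 3%N].

(* K is the quotient of the disjoint union of its tetrahedra by face pairings.
   Each triangle is a face of at most two tetrahedra, since it is glued to at
   most one other face.  Two tetrahedra meet along a simplex r only if this is
   forced by a chain of face pairings whose faces contain r. *)
Definition simplicial_triangulation n (K : {set {set 'I_n}}) : Prop :=
  [/\ simplicial_complex K,
      forall r, r \in K -> exists2 s, s \in tetrahedra K & r \subset s,
      forall f, f \in K -> #|f| = 3%N ->
        (#|[set s in tetrahedra K | f \subset s]| <= 2)%N
    & forall r s t, r \in K -> s \in tetrahedra K -> t \in tetrahedra K ->
        r \subset s -> r \subset t -> connect (share_face_around K r) s t].

Definition support (R : realType) n (x : 'rV[R]_n) : {set 'I_n} :=
  [set i | x 0 i != 0].

Definition realization (R : realType) n (K : {set {set 'I_n}}) :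
    set 'rV[R]_n :=
  [set x : 'rV[R]_n | [/\ forall i, 0 <= x 0 i, \sum_i x 0 i = 1
                        & support x \in K]]%classic.

Definition homeomorphic (T U : topologicalType) (A : set T) (B : set U) :
    Prop :=
  exists (f : T -> U) (g : U -> T),
    [/\ {within A, continuous f}%classic, {within B, continuous g}%classic,
        forall x, A x -> B (f x) /\ g (f x) = x
      & forall y, B y -> A (g y) /\ f (g y) = y].

Definition half_space3 (R : realType) : set 'rV[R]_3 :=
  [set y : 'rV[R]_3 | 0 <= y 0 0]%classic.

(* Topological 3-manifold, possibly with boundary.  The Hausdorff property and
   second countability hold for every subset of R^n; compactness holds for the
   realization of a finite complex. *)
Definition manifold3 (R : realType) n (X : set 'rV[R]_n) : Prop :=
  forall x, X x -> exists U : set 'rV[R]_n,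
    [/\ open U, U x
      & homeomorphic (X `&` U)%classic (@setT 'rV[R]_3) \/
        homeomorphic (X `&` U)%classic (@half_space3 R)].

(* [o a b c d] is the sign of the ordering (a, b, c, d) of a tetrahedron.  Two
   tetrahedra abcd and abce induce opposite orientations on the face abc
   exactly when these orderings have opposite signs. *)
Definition orientable_triangulation n (K : {set {set 'I_n}}) : Prop :=
  exists o : 'I_n -> 'I_n -> 'I_n -> 'I_n -> bool,
    forall a b c d, [set a; b; c; d] \in tetrahedra K ->
      [/\ o b a c d = ~~ o a b c d,
          o a c b d = ~~ o a b c d,
          o a b d c = ~~ o a b c d
        & forall e, e != d -> [set a; b; c; e] \in tetrahedra K ->
            o a b c e = ~~ o a b c d].

(* The normal cell structure of a normal surface S.  Its vertices are the
   points of S on the edges of the triangulation, located in R^n by [pos].  A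
   normal triangle or quadrilateral is given by the set of its corners, which
   determines it up to an isotopy of the tetrahedron fixing the edges and
   preserving the faces. *)
Record normal_cells (R : realType) n := NormalCells {
  corner : finType;
  pos : corner -> 'rV[R]_n;
  discs : {set {set corner}}
}.

Section NormalCells.
Context (R : realType) (n : nat).
Implicit Types (K : {set {set 'I_n}}) (S : normal_cells R n).

Definition edge_of S (p : corner S) : {set 'I_n} := support (pos p).

Definition carrier S (d : {set corner S}) : {set 'I_n} :=
  \bigcup_(p in d) edge_of p.

(* d has one corner on each edge of its tetrahedron that joins A to the
   complement of A, and no other corner. *)
Definition separates S (d : {set corner S}) (A : {set 'I_n}) : Prop :=
  A \subset carrier d /\
  forall e : {set 'I_n}, e \subset carrier d -> #|e| = 2%N ->
    #|[set p in d | edge_of p == e]| = (#|e :&: A| == 1%N).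

(* A triangle separates a vertex from the other three vertices, and a
   quadrilateral separates a pair of vertices from the other pair. *)
Definition normal_disc K S (d : {set corner S}) : Prop :=
  carrier d \in tetrahedra K /\
  exists A, [/\ separates d A, (0 < #|A|)%N & (#|A| <= 2)%N].

(* If d separates A from the remaining vertices of its tetrahedron, the point p
   on an edge of that tetrahedron lies strictly on the A-side of d. *)
Definition on_side S (d : {set corner S}) (A : {set 'I_n}) (p : corner S) :
    Prop :=
  edge_of p \subset A \/
  exists q u, [/\ q \in d, edge_of q = edge_of p, u \in A, u \in edge_of p
                & pos q 0 u < pos p 0 u].

(* Two normal discs of one tetrahedron are disjoint (after an isotopy fixing
   the corners) when the second lies in one of the two components of the
   complement of the first. *)
Definition disjoint_discs S (d d' : {set corner S}) : Prop :=
  exists2 A, separates d A & forall p, p \in d' -> on_side d A p.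

(* The arcs in which the discs meet the triangles of the triangulation.  A pair
   of corners of a disc bounds such an arc when it lies in a common triangle;
   opposite corners of a quadrilateral lie on opposite edges. *)
Definition arcs S : {set {set corner S}} :=
  [set a : {set corner S} | [&& #|a| == 2%N, #|carrier a| == 3%N
     & [exists d in discs S, a \subset d]]].

(* The last two conditions say that S meets each tetrahedron s in the discs
   of s only: a corner or an arc lying in s belongs to a disc of s, even if it
   comes from a disc of another tetrahedron. *)
Definition normal_surface K S : Prop :=
  [/\ injective (@pos R n S),
      forall p : corner S, @realization R n K (pos p) /\ #|edge_of p| = 2%N,
      forall d, d \in discs S -> normal_disc K d,
      forall d d', d \in discs S -> d' \in discs S -> d != d' ->
        carrier d = carrier d' -> disjoint_discs d d'
    & (forall (p : corner S) s, s \in tetrahedra K -> edge_of p \subset s ->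
         exists d, [/\ d \in discs S, p \in d & carrier d = s]) /\
      (forall a s, a \in arcs S -> s \in tetrahedra K -> carrier a \subset s ->
         exists d, [/\ d \in discs S, a \subset d & carrier d = s])].

Definition closed_surface S : Prop :=
  forall a, a \in arcs S -> #|[set d in discs S | a \subset d]| = 2%N.

Definition in_common_disc S : rel (corner S) :=
  fun p q => [exists d in discs S, (p \in d) && (q \in d)].

Definition connected_surface S : Prop :=
  (0 < #|corner S|)%N /\ forall p q, connect (@in_common_disc S) p q.

(* [o d p q] holds when the orientation of the disc d directs its arc {p, q}
   from p to q.  The directions must go around the boundary of each disc, and
   the two discs at an arc must induce opposite directions on it. *)
Definition orientable_surface S : Prop :=
  exists o : {set corner S} -> corner S -> corner S -> bool,
    forall d p q, d \in discs S -> [set p; q] \in arcs S ->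
        [set p; q] \subset d ->
      [/\ o d q p = ~~ o d p q,
          forall r, r != q -> [set p; r] \in arcs S -> [set p; r] \subset d ->
            o d p r = ~~ o d p q
        & forall d', d' \in discs S -> d' != d -> [set p; q] \subset d' ->
            o d' p q = ~~ o d p q].

Definition euler_char S : int :=
  #|corner S|%:Z - #|arcs S|%:Z + #|discs S|%:Z.

(* The genus of a closed connected orientable surface, from
   euler_char S = 2 - 2 * genus S. *)
Definition genus S : rat := (2 - euler_char S)%:~R / 2.

Definition num_quads S : nat := #|[set d in discs S | #|d| == 4%N]|.

End NormalCells.

(* Main.v *)
(* With t triangles, q quadrilaterals and V corners, counting arcs turns the
   claim into 12 + 3 t <= 6 V + 8 q.  Call a corner capped at both ends when it
   lies on normal triangles around either endpoint of its edge, and let D be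
   the number of these corners.

   The triangles around a vertex v that have exactly i sheets of S between
   themselves and v, measured along the edges at v, form a layer; a layer
   embeds as a set A of triangles in the link of v.  In a chart at v, the
   punctured neighbourhood of v is covered by two contractible sets with
   connected intersection, also when v lies on the boundary.  Therefore the
   link has trivial first cohomology over F_2, so by a duality argument the
   complement of A bounds its first Betti number, and each component of the
   complement has at least three edges in common with A.  If V_A is the number
   of vertices of A and b_A the number of its boundary edges, this gives
   6 V_A >= 12 + 3 |A| + b_A.  Summing over the layers counts each corner once,
   except for the D corners capped at both ends, which are counted twice.  At
   such a corner both layers have at least two boundary edges, which continue
   into different quadrilaterals.  Hence the sum of the b_A is at least 2 D, and
   D <= 2 q. *)
Require Import Defs.
From mathcomp Require Import all_boot all_order all_algebra.
From mathcomp Require Import all_classical all_reals all_analysis.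
From mathcomp Require Import ring lra zify fintype finset.
Set Implicit Arguments.
Unset Strict Implicit.
Unset Printing Implicit Defensive.
Import Order.TTheory GRing.Theory Num.Theory numFieldNormedType.Exports.
Local Open Scope ring_scope.

(** * Links of vertices have trivial first cohomology *)

(** The manifold hypothesis provides only topological charts, so a link is not at hand as a
    triangulated sphere or disc. What the chart yields is that every F_2 cocycle of the link is a
    coboundary. This suffices for the inequality that Euler's formula would give: with [E] edges in
    A and [c] components of its complement, [E <= V_A + |A| + c - 2]. The constants of the layer
    inequality come from multiplying this by 6 and inserting [2 E = 3 |A| + b_A] and [3 c <= b_A].
    The second of these is where a simplicial triangulation pays: an edge is determined by its two
    ends, so the part of the boundary of A facing one component, which has even degree at each
    vertex, cannot be a pair of edges with the same ends. In the final sum the doubly counted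
    corners cost [6 D], the rims return [2 D], and [D <= 2 q] turns the remaining [4 D] into the
    coefficient 8 of q. *)

Lemma norm_rV_le (R : realType) k (x : 'rV[R]_k) (r : R) : 0 <= r ->
  `|x| <= r <-> forall i, `|x 0 i| <= r.
Proof.
move=> r0; rewrite [`|x|]mx_normrE; split.
  by move/bigmax_leP => [_ h] i; apply: (h (0, i)).
by move=> h; apply/bigmax_leP; split=> // -[j i] _ /=; rewrite ord1.
Qed.

Lemma norm_coord_le (R : realType) k (x : 'rV[R]_k) i : `|x 0 i| <= `|x|.
Proof. by apply: (norm_rV_le x (normr_ge0 x)).1. Qed.

Lemma norm_rV_ge (R : realType) k (x : 'rV[R]_k) (r : R) : 0 < r ->
  r <= `|x| <-> exists i, r <= `|x 0 i|.
Proof.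
move=> r0; split=> [|[i]]; last by move/le_trans; apply; exact: norm_coord_le.
rewrite [`|x|]mx_normrE => /bigmax_geP[/=|[[j i] _ /=]]; first by lra.
by rewrite ord1 => h; exists i.
Qed.

Lemma locally_constant_segment (R : realType) (T : eqType) (h : R -> T) :
  (forall t, 0 <= t <= 1 -> exists2 e, 0 < e &
     forall u, 0 <= u <= 1 -> `|t - u| < e -> h u = h t) ->
  h 0 = h 1.
Proof.
move=> loc.
pose A : set R := `[0, 1]%classic.
have A01 (t : R) : A t <-> 0 <= t <= 1 by rewrite /A /= in_itv.
(* [W P] is open, and its trace on the segment is the set of [t] with [P (h t)]. Using it for the
   value [h 0] and for all other values makes the level set of [h 0] both open and closed in the
   segment. *)
pose W (P : T -> Prop) : set R :=
  (\bigcup_(te in [set te : R * R | [/\ P (h te.1), 0 < te.2 &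
      forall u, 0 <= u <= 1 -> `|te.1 - u| < te.2 -> h u = h te.1]])
    ball te.1 te.2)%classic.
have oW P : open (W P).
  by apply: bigcup_open => -[t e] _; exact: ball_open.
have WP P t : A t -> W P t <-> P (h t).
  move=> /A01 At; split; first by case=> -[u e] [/= Pu _ he] /he ->.
  by move=> Pt; have [e e0 he] := loc _ At; exists (t, e) => //; exact: ballxx.
have : [set t | A t /\ h t = h 0]%classic = A.
  apply: segment_connected.
  - by exists 0 => /=; split=> //; apply/A01; lra.
  - exists (W (fun y => y = h 0)) => //.
    by apply/seteqP; split=> t [At /(WP (fun y => y = h 0) t At)].
  - exists (~` W (fun y => y <> h 0))%classic; first exact: open_closedC.
    apply/seteqP; split=> t [At ht]; split=> //.
      by move/(WP (fun y => y <> h 0) t At).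
    by apply: contrapT => hn; apply: ht; apply/(WP (fun y => y <> h 0) t At).
move/seteqP => [_ /(_ 1)] []; last by [].
by apply/A01; lra.
Qed.


(* A discrete path lifting: [kappa] is summed along N + 1 equal steps of the
   segment from [z0], and the paths to close endpoints stay close. *)
Lemma star_primitive (R : realType) (V : normedModType R) (D A : set V)
    (kappa : V -> V -> bool) (eta M : R) (z0 : V) : 0 < eta ->
  (forall x y z, D x -> D y -> D z -> `|x - y| < eta -> `|x - z| < eta ->
     `|y - z| < eta -> kappa x y (+) kappa y z = kappa x z) ->
  (forall y t, A y -> 0 <= t <= 1 -> D (z0 + t *: (y - z0))) ->
  (forall y, A y -> `|y - z0| <= M) ->
  exists h : V -> bool, forall y z, A y -> A z -> `|y - z| < eta / 2 ->
    kappa y z = h y (+) h z.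
Proof.
move=> eta0 kD AD AM.
have [N MN] : exists N : nat, M / N.+1%:R < eta / 2.
  have [N] : exists N : nat, `|M / (eta / 2)| < N%:R.
    by exists (Num.truncn `|M / (eta / 2)|).+1; rewrite truncnS_gt.
  move=> hN; exists N; rewrite ltr_pdivrMr // mulrC -ltr_pdivrMr; last by lra.
  by apply: le_lt_trans (lt_trans hN _); rewrite ?ler_norm ?ltr_nat.
pose z (i : nat) (y : V) := z0 + (i%:R / N.+1%:R) *: (y - z0).
have zD i y : (i <= N.+1)%N -> A y -> D (z i y).
  move=> iN Ay; apply: AD => //; rewrite divr_ge0 //=.
  by rewrite ler_pdivrMr // mul1r ler_nat.
have z00 y : z 0%N y = z0 by rewrite /z mul0r scale0r addr0.
have zN y : z N.+1 y = y by rewrite /z divff // scale1r addrC subrK.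
have z_step i y : A y -> `|z i y - z i.+1 y| < eta / 2.
  move=> Ay; rewrite /z opprD addrACA subrr add0r -scalerBl normrZ.
  have -> : i%:R / N.+1%:R - i.+1%:R / N.+1%:R = - (1 / N.+1%:R) :> R.
    by rewrite -mulrBl -natr1; field.
  rewrite normrN ger0_norm ?divr_ge0 //; apply: le_lt_trans MN.
  by rewrite mul1r mulrC ler_wpM2r ?invr_ge0 // AM.
have z_close i x y : (i <= N.+1)%N -> `|x - y| < eta / 2 ->
    `|z i x - z i y| < eta / 2.
  move=> iN xy; rewrite /z opprD addrACA subrr add0r -scalerBr opprB.
  rewrite addrA subrK normrZ; apply: le_lt_trans xy.
  rewrite ler_piMl // ger0_norm ?divr_ge0 //.
  by rewrite ler_pdivrMr // mul1r ler_nat.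
pose h k y := \big[addb/false]_(i < k) kappa (z i y) (z i.+1 y).
exists (h N.+1) => x y Ax Ay xy; rewrite -{1}(zN x) -{1}(zN y).
suff H k : (k <= N.+1)%N -> kappa (z k x) (z k y) = h k x (+) h k y by exact: H.
elim: k => [_|k IH kN].
  rewrite /h !big_ord0 !z00; have Dz : D z0 by rewrite -(z00 x); exact: zD.
  by have := kD z0 z0 z0 Dz Dz Dz; rewrite subrr normr0 addbb => /(_ eta0 eta0 eta0).
have := IH (ltnW kN); rewrite /h !big_ord_recr /=.
(* The square with corners [z k x], [z k.+1 x], [z k.+1 y], [z k y] is cut by a diagonal into two
   triangles. Its sides are shorter than [eta / 2], hence the diagonal is shorter than [eta], and
   the cocycle condition applies to both triangles. *)
have k1 := kD _ _ _ (zD _ _ (ltnW kN) Ax) (zD _ _ kN Ax) (zD _ _ kN Ay).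
have k2 := kD _ _ _ (zD _ _ (ltnW kN) Ax) (zD _ _ (ltnW kN) Ay) (zD _ _ kN Ay).
have s1 := z_step k x Ax.
have s2 := z_step k y Ay.
have c1 := z_close k x y (ltnW kN) xy.
have c2 := z_close k.+1 x y kN xy.
have d : `|z k x - z k.+1 y| < eta.
  rewrite (splitr eta) -(subrK (z k y) (z k x)) -addrA.
  by apply: le_lt_trans (ler_normD _ _) _; exact: ltrD.
have lt2 u : u < eta / 2 -> u < eta by move=> ?; lra.
move: (k1 (lt2 _ s1) d (lt2 _ c2)) (k2 (lt2 _ c1) d (lt2 _ s2)) => <-.
case: (kappa (z k x) (z k.+1 x)); case: (kappa (z k y) (z k.+1 y));
case: (kappa (z k x) (z k y)); case: (kappa (z k.+1 x) (z k.+1 y)) => //=;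
by do 2![case: (\big[_/_]_(_ < _) _)].
Qed.

Lemma forall_ord3 (P : 'I_3 -> Prop) : (forall i, P i) <-> [/\ P 0, P 1 & P 2].
Proof.
split=> [H|[H0 H1 H2] i]; first by split.
have [->|i0] := eqVneq i 0; first by [].
have [->|i1] := eqVneq i 1; first by [].
suff -> : i = 2 by [].
by apply: val_inj; case: i i0 i1 => -[|[|[]]].
Qed.

Lemma exists_ord3 (P : 'I_3 -> Prop) : (exists i, P i) <-> [\/ P 0, P 1 | P 2].
Proof.
split; last by case=> ?; eexists; eassumption.
case=> i; move: i; apply/forall_ord3; split => ?; [apply: Or31|apply: Or32|apply: Or33];
  assumption.
Qed.

(** The norm is the maximum norm, so this is a cubical shell. The condition [P] on the first
    coordinate stands for the whole space or for the half-space, which treats interior and boundary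
    vertices at once. *)
Definition half_shell (R : realType) (P : R -> Prop) (p : 'rV[R]_3) (rho r : R)
    : set 'rV[R]_3 :=
  [set y : 'rV[R]_3 | [/\ P (y 0 0), rho <= `|y - p| & `|y - p| <= r]]%classic.

(** The sign [s] is 1 or -1. The cut is made in coordinate [1] because the half-space restricts
    coordinate [0] only, so that the centres of both caps stay in the chart. *)
Definition cap (R : realType) (P : R -> Prop) (p : 'rV[R]_3) (rho r s : R)
    : set 'rV[R]_3 :=
  [set y : 'rV[R]_3 | half_shell P p rho r y /\ s * (y 0 1 - p 0 1) <= rho / 2]%classic.

(** Segments from [z0] to the cap stay at distance at least [rho / 4] from [p]. For [t < 1 / 4],
    coordinate [1] is still far out on the side of [z0]. For larger [t], take a coordinate in which
    [y] is at distance at least [rho]: if it is [0] or [2], at least a quarter of that distance is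
    already reached; if it is [1], the cut forces [y] to be on the side of [z0]. *)
Lemma cap_primitive (R : realType) (P : R -> Prop) (p : 'rV[R]_3)
    (rho r eta s : R) (kappa : 'rV[R]_3 -> 'rV[R]_3 -> bool) :
  (forall a b, a <= b -> P a -> P b) -> P (p 0 0) ->
  0 < rho -> rho <= r -> 0 < eta -> s = 1 \/ s = -1 ->
  (let D := half_shell P p (rho / 4) r in
   forall x y z, D x -> D y -> D z -> `|x - y| < eta -> `|x - z| < eta ->
     `|y - z| < eta -> kappa x y (+) kappa y z = kappa x z) ->
  exists h : 'rV[R]_3 -> bool, forall y z,
    cap P p rho r s y -> cap P p rho r s z -> `|y - z| < eta / 2 ->
    kappa y z = h y (+) h z.
Proof.
move=> Pup Pp rho0 rhor eta0 s1 kD.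
pose z0 : 'rV[R]_3 := p - (s * r) *: delta_mx 0 1.
have z0E i : z0 0 i = p 0 i - s * r * (i == 1)%:R.
  by rewrite !mxE /=.
have r0 : 0 < r by lra.
apply: (star_primitive (D := half_shell P p (rho / 4) r) (M := r + r) (z0 := z0)) => //.
  move=> y t [[Py ry yr] sy] /andP[t0 t1].
  have ar i : `|y 0 i - p 0 i| <= r.
    by have := (norm_rV_le _ (ltW r0)).1 yr i; rewrite !mxE.
  have [a0 a1 a2] := (forall_ord3 _).1 ar.
  split.
  - rewrite !mxE /= mulr0 subr0.
    have [py|yp] := lerP (p 0 0) (y 0 0).
      by apply: Pup Pp; rewrite lerDl mulr_ge0 // subr_ge0.
    by apply: Pup Py; nra.
  - apply/norm_rV_ge; first by lra.
    move/norm_rV_ge: ry => /(_ rho0) /exists_ord3 /=; rewrite !mxE => ry.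
    apply/exists_ord3; rewrite /= !mxE /= !(mulr0, mulr1, subr0).
    move: a0 a1 a2; rewrite !ler_norml => /andP[a0 a0'] /andP[a1 a1'] /andP[a2 a2'].
    have low : t < 1 / 4 \/ `|y 0 1 - p 0 1| >= rho ->
        rho / 4 <= `|p 0 1 - s * r + t * (y 0 1 - (p 0 1 - s * r)) - p 0 1|.
      rewrite !ler_normr => hyp; apply/orP; have [es|es] := s1; subst s.
        by right; case: hyp => [?|/orP[?|?]]; nra.
      by left; case: hyp => [?|/orP[?|?]]; nra.
    have high a : 1 / 4 <= t -> rho <= `|a| -> rho / 4 <= `|t * a|.
      by move=> t4 ra; rewrite normrM ger0_norm //; nra.
    have addsub a b : a + b - a = b :> R by rewrite addrC addKr.
    have [tlt|tge] := ltrP t (1 / 4); first by apply: Or32; apply: low; left.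
    case: ry => ry; [apply: Or31|apply: Or32|apply: Or33].
    + by rewrite addsub; exact: high.
    + by apply: low; right.
    + by rewrite addsub; exact: high.
  - apply/(norm_rV_le _ (ltW r0)) => /=; apply/forall_ord3.
    rewrite /= !mxE /= !(mulr0, mulr1, subr0).
    move: a0 a1 a2; rewrite !ler_norml => /andP[a0 a0'] /andP[a1 a1'] /andP[a2 a2'].
    by split; apply/andP; split; have [es|es] := s1; subst s; nra.
move=> y [[Py ry yr] sy]; rewrite -(subrK p y) -addrA.
apply: le_trans (ler_normD _ _) _; rewrite lerD //.
rewrite opprB addrCA subrr addr0; apply/(norm_rV_le _ (ltW r0)) => i.
rewrite !mxE /= normrM; have [es|es] := s1; subst s; case: eqP => _ /=;
  by rewrite ?normr1 ?normr0 ?mulr0 ?mulr1 ?mul1r ?mulN1r ?normrN ?gtr0_norm // ltW.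
Qed.

(* Two caps around [p + r e_1] and [p - r e_1] cover the shell with a margin.
   Their overlap is connected, so the primitives of [kappa] on the two caps
   differ there by a constant. *)
Lemma shell_primitive (R : realType) (P : R -> Prop) (p : 'rV[R]_3)
    (rho r eta : R) (kappa : 'rV[R]_3 -> 'rV[R]_3 -> bool) :
  (forall a b, a <= b -> P a -> P b) -> P (p 0 0) ->
  0 < rho -> rho <= r -> 0 < eta ->
  (let D := half_shell P p (rho / 4) r in
   forall x y z, D x -> D y -> D z -> `|x - y| < eta -> `|x - z| < eta ->
     `|y - z| < eta -> kappa x y (+) kappa y z = kappa x z) ->
  exists (h : 'rV[R]_3 -> bool) (eps : R), 0 < eps /\
    forall y z, half_shell P p rho r y -> half_shell P p rho r z ->
      `|y - z| < eps -> kappa y z = h y (+) h z.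
Proof.
move=> Pup Pp rho0 rhor eta0 kD; have r0 : 0 < r by lra.
have [hA HA] := cap_primitive Pup Pp rho0 rhor eta0 (or_introl erefl) kD.
have [hB HB] := cap_primitive Pup Pp rho0 rhor eta0 (or_intror erefl) kD.
pose O y := cap P p rho r 1 y /\ cap P p rho r (-1) y.
pose phi y := hA y (+) hB y.
(* Along a segment inside the overlap both primitives change by the same values of [kappa], so their
   difference [phi] is locally constant. *)
have phi_seg y z : (forall t, 0 <= t <= 1 -> O (y + t *: (z - y))) -> phi y = phi z.
  move=> seg; pose h t := phi (y + t *: (z - y)).
  have -> : phi y = h 0 by rewrite /h scale0r addr0.
  have -> : phi z = h 1 by rewrite /h scale1r addrC subrK.
  apply: locally_constant_segment => t t01.
  have c0 : 0 < `|z - y| + 1 by have := normr_ge0 (z - y); lra.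
  exists (eta / 2 / (`|z - y| + 1)); first by rewrite divr_gt0 //; lra.
  move=> u u01; rewrite ltr_pdivlMr // => tu.
  have cl : `|y + u *: (z - y) - (y + t *: (z - y))| < eta / 2.
    rewrite opprD addrACA subrr add0r -scalerBl normrZ distrC.
    by apply: le_lt_trans tu; rewrite ler_wpM2l // lerDl.
  have [uA uB] := seg u u01; have [tA tB] := seg t t01.
  have := HA _ _ uA tA cl; rewrite (HB _ _ uB tB cl) /h /phi.
  by case: (hA _); case: (hB _); case: (hA _); case: (hB _).
pose pt (a b c : R) : 'rV[R]_3 := p + \row_(i < 3) [:: a; b; c]`_i.
have OE (a b c : R) : O (pt a b c) <->
    [/\ P (p 0 0 + a), `|a| <= r, `|b| <= rho / 2, `|c| <= r
      & rho <= `|a| \/ rho <= `|c|].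
  have ptp : pt a b c - p = \row_(i < 3) [:: a; b; c]`_i by rewrite addrC addKr.
  rewrite /O /cap /half_shell /= ptp; split.
    move=> [[[Pa /norm_rV_ge-/(_ rho0)/exists_ord3 ge] /(norm_rV_le _ (ltW r0))/forall_ord3 le s1] [_ s2]].
    move: ge le s1 s2 Pa; rewrite !mxE /= => ge [la lb lc] s1 s2 Pa.
    have b2 : `|b| <= rho / 2 by rewrite ler_norml; apply/andP; split; lra.
    by split=> //; case: ge => ?; [left|lra|right].
  move=> [Pa la lb lc ge].
  have le : `|\row_(i < 3) [:: a; b; c]`_i| <= r.
    apply/(norm_rV_le _ (ltW r0))/forall_ord3; rewrite !mxE /=.
    by split=> //; lra.
  have ge' : rho <= `|\row_(i < 3) [:: a; b; c]`_i|.
    apply/norm_rV_ge => //; apply/exists_ord3; rewrite !mxE /=.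
    by case: ge => ?; [apply: Or31|apply: Or33].
  move: lb; rewrite ler_norml => /andP[b1 b2].
  by split; (split; first by split; rewrite // !mxE /=); rewrite !mxE /=; lra.
have pt_seg a b c a' b' c' : (forall t, 0 <= t <= 1 ->
    O (pt (a + t * (a' - a)) (b + t * (b' - b)) (c + t * (c' - c)))) ->
    phi (pt a b c) = phi (pt a' b' c').
  move=> H; apply: phi_seg => t /H; congr (O _).
  by apply/rowP; apply/forall_ord3; rewrite !mxE /=; split; ring.
have norm_seg (a b m t : R) : 0 <= t <= 1 -> `|a| <= m -> `|b| <= m ->
    `|a + t * (b - a)| <= m.
  move=> /andP[t0 t1]; rewrite !ler_norml => /andP[a0 a1] /andP[b0 b1].
  by apply/andP; split; nra.
have P_seg (a t : R) : 0 <= t <= 1 -> `|a| <= r -> P (p 0 0 + a) ->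
    P (p 0 0 + (a + t * (r - a))).
  move=> /andP[t0 t1] /ler_normlP[_ ar]; apply: Pup.
  by rewrite lerD2l lerDl mulr_ge0 // subr_ge0.
have step1 a b c : O (pt a b c) -> rho <= a \/ rho <= `|c| ->
    phi (pt a b c) = phi (pt r 0 0).
  move=> /OE[Pa la lb lc _] ac; transitivity (phi (pt r b c)).
    apply: pt_seg => t t01; apply/OE; rewrite !subrr !mulr0 !addr0.
    have rr : `|r| <= r by rewrite gtr0_norm.
    split=> //; [exact: P_seg|exact: norm_seg|].
    case: ac => [ra|]; [left|by right].
    by move: t01 la => /andP[t0 t1] /ler_normlP[_ la]; rewrite ler_normr; apply/orP; left; nra.
  apply: pt_seg => t t01; apply/OE; rewrite !subrr !mulr0 !addr0.
  have n0 m : 0 < m -> `|0 : R| <= m by move=> /ltW; rewrite normr0.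
  split=> //; try by [rewrite gtr0_norm|apply: norm_seg => //; apply: n0; lra].
  - by apply: Pup Pp; rewrite lerDl ltW.
  - by left; rewrite gtr0_norm.
(* In the coordinates [a] and [c] the overlap is a square ring, possibly cut by [P]. As [P] is only
   known to be upward closed, every path used here raises the first coordinate or leaves it fixed
   until it reaches [r]. The remaining case is [a <= - rho] with small [c]: there [c] is first moved
   to [r], which leads around the hole. *)
have step a b c : O (pt a b c) -> phi (pt a b c) = phi (pt r 0 0).
  move=> Oabc; have [Pa la lb lc ac] := (OE _ _ _).1 Oabc.
  have [?|rc] := lerP rho `|c|; first by apply: step1 => //; right.
  have [?|ra] := lerP rho a; first by apply: step1 => //; left.
  have {}ac : rho <= `|a| by case: ac => //; lra.
  have cr t : 0 <= t <= 1 -> O (pt a b (c + t * (r - c))).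
    move=> t01; apply/OE; split=> //; last by left.
    by apply: norm_seg => //; rewrite gtr0_norm.
  transitivity (phi (pt a b r)).
    by apply: pt_seg => t t01; rewrite !subrr !mulr0 !addr0; exact: cr.
  apply: step1; last by right; rewrite gtr0_norm.
  by have := cr 1; rewrite mul1r addrC subrK; apply; lra.
have ptE (y : 'rV[R]_3) : y = pt (y 0 0 - p 0 0) (y 0 1 - p 0 1) (y 0 2 - p 0 2).
  by apply/rowP; apply/forall_ord3; rewrite !mxE /=; split; ring.
have phiO (y : 'rV[R]_3) : O y -> hA y = hB y (+) phi (pt r 0 0).
  rewrite {1}(ptE y) => /step; rewrite -ptE => <-.
  by rewrite /phi addbC addbK.
(* The bound [rho / 2] in [eps] is the margin: if [y] and [z] lie on different sides of the cut and
   are this close, both belong to both caps, where the two formulas agree. *)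
exists (fun y : 'rV[R]_3 => if y 0 1 - p 0 1 <= rho / 2 then hA y
                 else hB y (+) phi (pt r 0 0)), (Num.min (eta / 2) (rho / 2)).
split; first by rewrite lt_min; apply/andP; split; lra.
have mixed (y z : 'rV[R]_3) : half_shell P p rho r y -> half_shell P p rho r z ->
    `|y - z| < eta / 2 -> `|y - z| < rho / 2 ->
    y 0 1 - p 0 1 <= rho / 2 -> rho / 2 < z 0 1 - p 0 1 ->
    kappa y z = hA y (+) (hB z (+) phi (pt r 0 0)).
  move=> Sy Sz yz1 yz2 ly lz.
  have := le_lt_trans (norm_coord_le _ 1) yz2; rewrite !mxE ltr_norml => /andP[d1 d2].
  have yB : cap P p rho r (-1) y by split=> //; lra.
  have zB : cap P p rho r (-1) z by split=> //; lra.
  have yA : cap P p rho r 1 y by split=> //; lra.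
  rewrite (HB _ _ yB zB yz1) (phiO y); last by split.
  by case: (hB y); case: (hB z); case: (phi _).
move=> y z Sy Sz; rewrite lt_min => /andP[yz1 yz2].
have [ly|ly] := lerP (y 0 1 - p 0 1) (rho / 2);
  have [lz|lz] := lerP (z 0 1 - p 0 1) (rho / 2).
- by apply: HA => //; split=> //; lra.
- exact: mixed.
- have yz1' : `|z - y| < eta / 2 by rewrite distrC.
  have yz2' : `|z - y| < rho / 2 by rewrite distrC.
  have D y' : half_shell P p rho r y' -> half_shell P p (rho / 4) r y'.
    by move=> [? ? ?]; split=> //; lra.
  rewrite addbC -(mixed z y) //.
  have yy0 : kappa y y = false.
    have := kD y y y (D y Sy) (D y Sy) (D y Sy).
    by rewrite subrr normr0 addbb => /(_ eta0 eta0 eta0).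
  have := kD y z y (D y Sy) (D z Sz) (D y Sy).
  rewrite subrr normr0 yy0 => H.
  have lt2 u : u < eta / 2 -> u < eta by move=> ?; lra.
  move: (H (lt2 _ yz1) eta0 (lt2 _ yz1')).
  by case: (kappa y z); case: (kappa z y).
- by rewrite (HB y z) //; [case: (hB y); case: (hB z); case: (phi _)|split=> //; lra..].
Qed.

(** * Compactness, charts and the cohomology of a vertex link *)

Lemma within_continuous_dist (R : realType) (V W : normedModType R)
    (A : set V) (f : V -> W) : {within A, continuous f}%classic ->
  forall x e, A x -> 0 < e -> exists2 d, 0 < d &
    forall y, A y -> `|x - y| < d -> `|f x - f y| < e.
Proof.
move=> /subspace_continuousP cf x e Ax e0.
have /cvgrPdist_lt /(_ e e0) := cf x Ax.
move=> /nbhs_ballP [d /= d0 H]; exists d => // y Ay xy.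
by apply: H => //; rewrite -ball_normE.
Qed.

Lemma lebesgue_number (R : realType) (V : normedModType R) (I : Type)
    (D : set V) (Q : I -> V -> Prop) : compact D ->
  (forall x, D x -> exists i, exists2 e, 0 < e &
     forall y, D y -> `|x - y| < e -> Q i y) ->
  exists2 eta, 0 < eta & forall x, D x -> exists i,
     forall y, D y -> `|x - y| < eta -> Q i y.
Proof.
move=> /compact_near_coveringP cD loc.
have : \forall e \near ((0 : R)^'+)%classic, (D `<=` [set x | exists i,
    forall y, D y -> `|x - y| < e -> Q i y])%classic.
  apply: (cD _ _ (fun e x => exists i, forall y, D y -> `|x - y| < e -> Q i y)).
  move=> x Dx; have [i [e e0 H]] := loc x Dx.
  exists (ball x (e / 2), [set t | t < e / 2])%classic; first split=> /=.
  - by apply: nbhsx_ballx; lra.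
  - by apply: nbhs_right_lt; lra.
  move=> [y t] /= [xy te]; exists i => z Dz yz; apply: H => //.
  rewrite -(subrK y x) -addrA (splitr e).
  apply: le_lt_trans (ler_normD _ _) _; apply: ltrD; last exact: lt_trans te.
  by move: xy; rewrite -ball_normE.
move=> H; have [e [e0 He]] := filter_ex (filterI (nbhs_right_gt (0 : R)) H).
by exists e.
Qed.

Lemma dist_continuous (R : realType) (V : normedModType R) (p : V) :
  continuous (fun y : V => `|y - p|).
Proof.
move=> y; apply: (@cvg_norm _ _ _ _ _ (fun y => y - p)).
by apply: (@cvgB _ _ _ _ _ id (fun=> p)); [exact: cvg_id|exact: cvg_cst].
Qed.

Lemma half_shell_compact (R : realType) (P : R -> Prop) (p : 'rV[R]_3) (rho r : R) :
  closed [set a | P a]%classic -> compact (half_shell P p rho r).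
Proof.
move=> cP.
have cn : continuous (fun y : 'rV[R]_3 => `|y - p|).
  exact: dist_continuous.
have -> : half_shell P p rho r = ((fun y : 'rV[R]_3 => y 0 0) @^-1` [set a | P a]
    `&` ((fun y : 'rV[R]_3 => `|y - p|) @^-1` [set a | rho <= a]
    `&` (fun y : 'rV[R]_3 => `|y - p|) @^-1` [set a | a <= r]))%classic.
  by apply/seteqP; split=> y /=; [case|move=> [? []]].
apply: bounded_closed_compact.
  exists (r + `|p|); split; first exact: num_real.
  move=> M rM y [_ [_ yr]]; apply: le_trans (ltW rM).
  by rewrite -(subrK p y); apply: le_trans (ler_normD _ _) _; rewrite lerD2r.
apply: closedI.
  by apply: preimage_closed => // y _; apply: coord_continuous.
apply: closedI; apply: preimage_closed.
- by move=> y _; exact: cn.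
- exact: closed_ge.
- by move=> y _; exact: cn.
- exact: closed_le.
Qed.

Lemma manifold3_chart (R : realType) n (X : set 'rV[R]_n) x :
  manifold3 X -> X x ->
  exists (U : set 'rV[R]_n) (P : R -> Prop), [/\ open U, U x,
    forall a b, a <= b -> P a -> P b, closed [set a | P a]%classic &
    homeomorphic (X `&` U)%classic [set y : 'rV[R]_3 | P (y 0 0)]%classic].
Proof.
move=> mX /mX [U [oU Ux [hU|hU]]].
  by exists U, (fun=> True); split=> //; exact: closedT.
exists U, (fun a => 0 <= a); split=> //.
by move=> a b ab a0; exact: le_trans ab.
Qed.

Lemma realization_ge0 (R : realType) n K (x : 'rV[R]_n) i :
  realization K x -> 0 <= x 0 i.
Proof. by case. Qed.

Lemma realization_le1 (R : realType) n K (x : 'rV[R]_n) i :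
  realization K x -> x 0 i <= 1.
Proof.
by case=> x0 <- _; rewrite (bigD1 i) //= lerDl sumr_ge0.
Qed.

Lemma realization_vertex_dist (R : realType) n K (x : 'rV[R]_n) v :
  realization K x -> `|delta_mx 0 v - x| <= 1 - x 0 v.
Proof.
move=> Kx; have [x0 x1 _] := Kx; have xv := realization_le1 v Kx.
apply/norm_rV_le; first by rewrite subr_ge0.
move=> i; rewrite !mxE /=; have [->|iv] := eqVneq i v.
  by rewrite ger0_norm ?subr_ge0.
rewrite sub0r normrN ger0_norm // lerBrDl -x1 (bigD1 v) //= lerD2l.
by rewrite (bigD1 i) //= lerDl sumr_ge0.
Qed.

Lemma realization_vertex (R : realType) n K (x : 'rV[R]_n) v :
  realization K x -> (forall w, w != v -> x 0 w = 0) -> x = delta_mx 0 v.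
Proof.
move=> [_ x1 _] xw; apply/rowP => i; rewrite !mxE /=.
have [->|iv] := eqVneq i v; last by rewrite xw.
by move: x1; rewrite (bigD1 v) //= big1 ?addr0.
Qed.

Lemma card_set4 (T : finType) (a b c d : T) :
  uniq [:: a; b; c; d] -> #|[set a; b; c; d]| = 4%N.
Proof.
move=> /card_uniqP /= <-; apply: eq_card => x.
by rewrite !inE -!orbA.
Qed.

(** A comparison in the style of Cech cohomology. Points of a shell in the chart are labelled by
    vertices of [K] other than [v], so that [c] becomes a local cocycle on the shell. Its primitive
    is then read off on the level set where the coordinate at [v] equals [1 - s], a copy of the link
    inside the shell. *)
Lemma link_cohomology (R : realType) n (K : {set {set 'I_n}}) (v : 'I_n)
    (c : 'I_n -> 'I_n -> bool) :
  simplicial_complex K -> manifold3 (realization (R := R) K) ->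
  [set v] \in K ->
  (forall w, c w w = false) -> (forall w u, c w u = c u w) ->
  (forall w u t, #|[set v; w; u; t]| = 4%N -> [set v; w; u; t] \in K ->
     c w u (+) c u t = c w t) ->
  exists f : 'I_n -> bool, forall w u, w != v -> u != v ->
    [set v; w; u] \in K -> c w u = f w (+) f u.
Proof.
move=> [K0 Ksub] mK Kv cww csym ctri.
have coc s w u t : s \in K -> v \in s -> w \in s -> u \in s -> t \in s ->
    w != v -> u != v -> t != v -> c w u (+) c u t = c w t.
  move=> Ks vs ws us ts wv uv tv.
  have [->|wu] := eqVneq w u; first by rewrite cww.
  have [->|ut] := eqVneq u t; first by rewrite cww addbF.
  have [->|wt] := eqVneq w t; first by rewrite cww csym addbb.
  apply: ctri.
    by rewrite card_set4 //= !inE !(eq_sym v) (negPf wv) (negPf uv) (negPf tv) (negPf wu) (negPf wt) (negPf ut).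
  apply: (Ksub s) => //.
    by apply/fintype.subsetP => i; rewrite !inE -!orbA => /or4P[] /eqP->.
  by apply/finset.set0Pn; exists v; rewrite !inE eqxx.
pose X := realization (R := R) K.
pose a : 'rV[R]_n := delta_mx 0 v.
have suppa : Defs.support a = [set v].
  by apply/finset.setP => i; rewrite !inE mxE eqxx /= pnatr_eq0; case: (i == v).
have Xa : X a.
  split; [by move=> i; rewrite mxE; case: (_ && _)| |by rewrite suppa].
  rewrite (bigD1 v) //= mxE !eqxx big1 ?addr0 // => i iv.
  by rewrite mxE (negPf iv) andbF.
have [U [P [oU Ua Pup Pcl [f [g [cf cg fXU gY]]]]]] := manifold3_chart mK Xa.
set Y := [set y | _]%classic in gY cg fXU.
pose p := f a.
have [Yp gp] : Y p /\ g p = a by apply: fXU.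
have {}cf := within_continuous_dist cf.
have {}cg := within_continuous_dist cg.
(* Choice of scales. Within [r0] of [p] the image under [g] keeps a positive coordinate at [v]. The
   number [s] is so small that the level [1 - s] lies in [U] and is sent into the ball of radius
   [r]. Points of this level are at distance at least [s] from [a], so the choice of [rho] keeps
   their images at distance at least [rho] from [p]. *)
have [r0 r00 Hr0] := cg p 1 Yp ltr01.
pose r := r0 / 2; have rgt0 : 0 < r by rewrite divr_gt0.
have [d1 d10 Hd1] : exists2 d, 0 < d & forall x, `|a - x| < d -> U x.
  have /nbhs_ballP [d /= d0 H] := open_nbhs_nbhs (conj oU Ua).
  by exists d => // x ax; apply: H; rewrite -ball_normE.
have [d2 d20 Hd2] := cf a r (conj Xa Ua) rgt0.
pose s := Num.min (Num.min d1 d2) 1 / 2.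
have mn : [/\ 0 < s, s < d1, s < d2 & s < 1].
  have m0 : 0 < Num.min (Num.min d1 d2) 1 by rewrite !lt_min d10 d20 ltr01.
  have : [/\ Num.min (Num.min d1 d2) 1 <= d1, Num.min (Num.min d1 d2) 1 <= d2 &
      Num.min (Num.min d1 d2) 1 <= 1] by rewrite !ge_min !lexx !orbT.
  rewrite /s; move: m0; move: (Num.min (Num.min d1 d2) 1) => m m0 [m1 m2 m3].
  by split; lra.
have [s0 sd1 sd2 s1] := mn.
have [d3 d30 Hd3] := cg p s Yp s0.
pose rho := Num.min d3 r.
have rho0 : 0 < rho by rewrite lt_min d30.
have rhor : rho <= r by rewrite ge_min lexx orbT.
have level x : X x -> x 0 v = 1 - s ->
    [/\ (X `&` U)%classic x, g (f x) = x & half_shell P p rho r (f x)].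
  move=> Xx xv; have dx := realization_vertex_dist v Xx.
  rewrite xv opprB addrCA subrr addr0 -/a in dx.
  have XUx : (X `&` U)%classic x by split=> //; apply: Hd1; exact: le_lt_trans sd1.
  have [Yfx gfx] := fXU _ XUx; split=> //; split=> //.
    rewrite leNgt; apply/negP; rewrite lt_min => /andP[lt3 _].
    have := Hd3 (f x) Yfx; rewrite distrC => /(_ lt3); rewrite gp gfx => ax.
    have := le_lt_trans (norm_coord_le _ v) ax.
    by rewrite !mxE !eqxx xv opprB addrCA subrr addr0 ger0_norm ?ltxx // ltW.
  by rewrite distrC ltW // Hd2 //; exact: le_lt_trans sd2.
pose D := half_shell P p (rho / 4) r.
have DX y : D y -> X (g y) /\ 0 < g y 0 v /\ exists2 w, w != v & g y 0 w != 0.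
  move=> [Yy y1 y2]; have [[Xgy _] fgy] := gY y Yy; split=> //; split.
    have := Hr0 y Yy; rewrite distrC gp => H.
    have /H ag : `|y - p| < r0 by apply: le_lt_trans y2 _; rewrite /r; lra.
    have := le_lt_trans (norm_coord_le _ v) ag.
    by rewrite !mxE !eqxx /= ltr_norml => /andP[_]; lra.
  apply: contrapT => hn.
  have ga : g y = a.
    apply: realization_vertex Xgy _ => w wv; apply/eqP.
    by apply: contrapT => /negP ?; apply: hn; exists w.
  have yp : y = p by rewrite -fgy ga.
  by move: y1; rewrite yp subrr normr0; lra.
pose Q w y := w != v /\ g y 0 w != 0.
have [eta eta0 Heta] : exists2 eta, 0 < eta & forall x, D x -> exists w,
    forall y, D y -> `|x - y| < eta -> Q w y.
  apply: lebesgue_number; first exact: half_shell_compact.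
  move=> x Dx; have [Xgx [_ [w wv gw]]] := DX x Dx; exists w.
  have Yx : Y x by case: Dx.
  have gw0 : 0 < g x 0 w by rewrite lt0r gw; exact: realization_ge0 Xgx.
  have [e e0 He] := cg x (g x 0 w) Yx gw0; exists e => // y Dy xy; split=> //.
  have Yy : Y y by case: Dy.
  have := le_lt_trans (norm_coord_le _ w) (He y Yy xy).
  rewrite !mxE; apply: contraTneq => ->.
  by rewrite subr0 ger0_norm ?ltxx // ltW.
(* The open star of [wf x] contains the image of the eta-ball around [x], which
   makes [c (wf x) (wf y)] a cocycle for points at distance less than [eta]. *)
have /choice[wf Hwf] (x : 'rV[R]_3) : exists w, D x ->
    forall y, D y -> `|x - y| < eta -> Q w y.
  have [Dx|nDx] := pselect (D x); last by exists v.
  by have [w Hw] := Heta x Dx; exists w.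
have Qself x : D x -> Q (wf x) x.
  by move=> Dx; apply: Hwf => //; rewrite subrr normr0.
have [h [eps [eps0 Hh]]] : exists (h : 'rV[R]_3 -> bool) (eps : R), 0 < eps /\
    forall y z, half_shell P p rho r y -> half_shell P p rho r z ->
      `|y - z| < eps -> c (wf y) (wf z) = h y (+) h z.
  apply: (shell_primitive (eta := eta)) => // D' x y z Dx Dy Dz xy xz yz.
  have [Xgx [gxv _]] := DX x Dx; have [_ _ Kx] := Xgx.
  have [xv xx] := Qself x Dx.
  have [yv yx] : Q (wf y) x by apply: Hwf => //; rewrite distrC.
  have [zv zx] : Q (wf z) x by apply: Hwf => //; rewrite distrC.
  by apply: (coc (Defs.support (g x))); rewrite // inE // gt_eqF.
have shD y : half_shell P p rho r y -> D y by move=> [? ? ?]; split=> //; lra.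
(* The value at [w] is taken where the edge from [v] to [w] meets the level [1 - s]. Below, [x t]
   runs within this level along the link edge from [w] to [u]. *)
exists (fun w => h (f ((1 - s) *: a + s *: delta_mx 0 w))) => w u wv uv Kvwu.
have [<-|wu] := eqVneq w u; first by rewrite cww addbb.
pose x t : 'rV[R]_n :=
  (1 - s) *: a + s *: ((1 - t) *: delta_mx 0 w + t *: delta_mx 0 u).
have xE t i : x t 0 i = (1 - s) * (i == v)%:R
    + s * ((1 - t) * (i == w)%:R + t * (i == u)%:R) by rewrite !mxE /=.
have Xx t : 0 <= t <= 1 -> X (x t).
  move=> /andP[t0 t1]; split.
  - move=> i; rewrite xE; do 3!case: (_ == _) => /=; nra.
  - under eq_bigr do rewrite xE.
    rewrite !(big_split, =^~ mulr_sumr) /=.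
    have one j : \sum_(i < n) (i == j)%:R = 1 :> R.
      rewrite (bigD1 j) //= eqxx big1 ?addr0 // => i ij.
      by rewrite (negPf ij).
    by rewrite !one; ring.
  - apply: (Ksub [set v; w; u]) => //.
      apply/fintype.subsetP => i; rewrite !inE xE; apply: contraNT.
      rewrite !negb_or -andbA => /and3P[/negPf-> /negPf-> /negPf->].
      by rewrite /= !(mulr0, addr0).
    apply/finset.set0Pn; exists v; rewrite inE xE eqxx !(eq_sym v) (negPf wv) (negPf uv) /=.
    by rewrite !mulr0 addr0 mulr0 addr0 mulr1; apply/eqP; lra.
have xv t : x t 0 v = 1 - s.
  by rewrite xE eqxx !(eq_sym v) (negPf wv) (negPf uv) !mulr0 addr0 mulr0 addr0 mulr1.
pose z t := f (x t).
have lev t : 0 <= t <= 1 ->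
    [/\ (X `&` U)%classic (x t), g (z t) = x t & half_shell P p rho r (z t)].
  by move=> /Xx Xt; exact: level.
have wfz t : 0 <= t <= 1 -> wf (z t) != v /\ x t 0 (wf (z t)) != 0.
  by move=> t01; have [_ <- /shD/Qself[]] := lev t t01.
have wfwu t : 0 <= t <= 1 -> wf (z t) = w \/ wf (z t) = u.
  move=> /wfz[]; rewrite xE; case: (_ == v) => // _.
  case: (eqVneq _ w) => [|_]; first by left.
  case: (eqVneq _ u) => [|_]; first by right.
  by rewrite !mulr0 addr0 mulr0 addr0 eqxx.
(* On this path the label is [w] or [u], and [h] jumps by [c w u] exactly when the label changes.
   Adding the jump for the label [u] makes [chi] locally constant. The labels at the ends are
   forced, since only one coordinate besides that of [v] is nonzero there. *)
pose chi t := h (z t) (+) (if wf (z t) == u then c w u else false).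
have : chi 0 = chi 1.
  apply: locally_constant_segment => t t01.
  have [XUt gz zt] := lev t t01.
  have [d d0 Hd] := cf (x t) eps XUt eps0.
  exists d => // t' t'01 tt'; have [XUt' gz' zt'] := lev t' t'01.
  have zz : `|z t - z t'| < eps.
    apply: Hd => //; apply: le_lt_trans tt'.
    apply/norm_rV_le; first exact: normr_ge0.
    move=> i; rewrite !mxE /= -/(delta_mx 0 w).
    have -> : (1 - s) * (i == v)%:R + s * ((1 - t) * (i == w)%:R + t * (i == u)%:R) -
      ((1 - s) * (i == v)%:R + s * ((1 - t') * (i == w)%:R + t' * (i == u)%:R)) =
      (t - t') * (s * ((i == u)%:R - (i == w)%:R)) by ring.
    rewrite normrM ler_piMr // normrM ger0_norm ?ltW //.
    have : `|(i == u)%:R - (i == w)%:R : R| <= 1.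
      by do 2!case: (_ == _) => /=; rewrite ?subrr ?subr0 ?sub0r ?normrN ?normr1 ?normr0.
    have := normr_ge0 ((i == u)%:R - (i == w)%:R : R); nra.
  have := Hh _ _ zt zt' zz; rewrite /chi.
  case: (wfwu t t01) => ->; case: (wfwu t' t'01) => ->;
    rewrite ?cww ?eqxx ?(negPf wu) ?(csym u w);
    by case: (h _); case: (h _); case: (c _ _).
have w0 : wf (z 0) = w.
  have [|//|e] := wfwu 0; first by rewrite lexx ler01.
  have [|_] := wfz 0; first by rewrite lexx ler01.
  by rewrite e xE (negPf uv) (eq_sym u w) (negPf wu) !mulr0 mul0r addr0 mulr0 addr0 eqxx.
have w1 : wf (z 1) = u.
  have [|e|//] := wfwu 1; first by rewrite lexx ler01.
  have [|_] := wfz 1; first by rewrite lexx ler01.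
  by rewrite e xE (negPf wv) (negPf wu) subrr !mulr0 mul0r addr0 mulr0 addr0 eqxx.
rewrite /chi w0 w1 eqxx (negPf wu) addbF => H.
have -> : (1 - s) *: a + s *: delta_mx 0 w = x 0.
  by rewrite /x subr0 scale1r scale0r addr0.
have -> : (1 - s) *: a + s *: delta_mx 0 u = x 1.
  by rewrite /x subrr scale1r scale0r add0r.
by move: H; rewrite /z => ->; case: (h _); case: (c _ _).
Qed.

(** * Subcomplexes of a surface with trivial first cohomology *)

Definition cofaces (T : finType) (C : {set {set T}}) (e : {set T}) : {set {set T}} :=
  [set t in C | e \subset t].

Definition edges_of (T : finType) (C : {set {set T}}) : {set {set T}} :=
  [set e : {set T} | (#|e| == 2%N) && [exists t in C, e \subset t]].

Lemma odd_sum_card (I : finType) (P : pred I) (F : I -> nat) :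
  odd (\sum_(i | P i) F i) = odd #|[set i | P i && odd (F i)]|.
Proof.
rewrite -sum1_card (big_morph odd oddD (erefl _)).
rewrite [in RHS](big_morph odd oddD (erefl _)) /=.
rewrite [in RHS](eq_bigl (fun i => P i && odd (F i))); last by move=> i; rewrite inE.
rewrite big_mkcondr /=; apply: eq_bigr => i _; by case: odd.
Qed.

Lemma card_pairs_triple (T : finType) (t : {set T}) : #|t| = 3%N ->
  #|[set e : {set T} | (e \subset t) && (#|e| == 2%N)]| = 3%N.
Proof. by move=> t3; rewrite cards_draws t3. Qed.

Lemma card_pairs_at (T : finType) (t : {set T}) x : #|t| = 3%N -> x \in t ->
  #|[set e : {set T} | [&& x \in e, #|e| == 2%N & e \subset t]]| = 2%N.
Proof.
move=> t3 xt; have := card_pairs_triple t3.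
rewrite -(cardsID [set e : {set T} | x \in e]).
have -> : [set e : {set T} | (e \subset t) && (#|e| == 2%N)] :\: [set e : {set T} | x \in e]
    = [set e : {set T} | (e \subset t :\ x) && (#|e| == 2%N)].
  by apply/setP => e; rewrite !inE subsetD1 andbA (andbC (x \notin e)).
rewrite cards_draws (_ : #|t :\ x| = 2%N); last by rewrite (cardsD1 x) xt in t3; case: t3.
rewrite binn addn1 => -[H]; rewrite -[RHS]H; apply: eq_card => e.
by rewrite !inE [RHS]andbC; congr (_ && _); rewrite andbC.
Qed.

(** The edges with an odd number of cofaces form the mod 2 boundary of the chain [C], and a boundary
    is a cycle: every triangle at [x] has two edges at [x]. *)
Lemma odd_edges_at_even (T : finType) (C : {set {set T}}) x :
  (forall t, t \in C -> #|t| = 3%N) ->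
  ~~ odd #|[set e : {set T} | [&& x \in e, #|e| == 2%N & odd #|cofaces C e|]]|.
Proof.
move=> C3.
have : ~~ odd (\sum_(e : {set T} | (x \in e) && (#|e| == 2%N)) #|cofaces C e|).
  have -> : (\sum_(e : {set T} | (x \in e) && (#|e| == 2%N)) #|cofaces C e| =
      \sum_(t in C | x \in t) 2)%N.
    transitivity (\sum_(e : {set T} | (x \in e) && (#|e| == 2%N))
        \sum_(t in C | e \subset t) 1)%N.
      by apply: eq_bigr => e _; rewrite -sum1_card; apply: eq_bigl => t; rewrite inE.
    rewrite (exchange_big_dep (fun t => (t \in C) && (x \in t))) /=; last first.
      by move=> e t /andP[xe _] /andP[-> /subsetP]; apply.
    apply: eq_bigr => t /andP[tC xt]; rewrite -[RHS](card_pairs_at (C3 _ tC) xt) -sum1_card.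
    by apply: eq_bigl => e; rewrite inE tC /= andbA.
  by rewrite sum_nat_const oddM andbF.
rewrite odd_sum_card; congr (~~ odd _); apply: eq_card => e.
by rewrite !inE andbA.
Qed.

Lemma card2_eq (T : finType) (e : {set T}) x y : #|e| = 2%N -> x \in e -> y \in e ->
  x != y -> e = [set x; y].
Proof.
move=> e2 xe ye xy; apply/esym/eqP; rewrite eqEcard subUset !sub1set xe ye /=.
by rewrite e2 cards2 xy.
Qed.

Definition adjacent (T : finType) (C : {set {set T}}) : rel {set T} :=
  fun t t' => [&& t \in C, t' \in C & #|t :&: t'| == 2%N].

Lemma adjacent_sym (T : finType) (C : {set {set T}}) : symmetric (adjacent C).
Proof. by move=> t t'; rewrite /adjacent setIC; case: (t \in C); case: (t' \in C). Qed.

Definition coboundary (T : finType) (c : {set T} -> 'F_2) (t : {set T}) : 'F_2 :=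
  \sum_(e : {set T} | (e \subset t) && (#|e| == 2%N)) c e.

Lemma F2_addrr (x : 'F_2) : x + x = 0.
Proof. by apply/val_inj; case: x => -[|[|]]. Qed.

Lemma F2_natr (k : nat) : k%:R = (odd k)%:R :> 'F_2.
Proof. by elim: k => // k IH; rewrite mulrSr IH /=; case: (odd k); apply/val_inj. Qed.

(** [L] stands for the link of a vertex and [A] for a layer in it. [L] may have a boundary, but by
    [AE] no boundary edge of [L] has an end in [A]. *)
Section PlanarSubcomplex.
Context (T : finType) (L A : {set {set T}}).
Context (L3 : forall t, t \in L -> #|t| = 3%N)
  (L2 : forall e : {set T}, #|e| = 2%N -> (#|cofaces L e| <= 2)%N)
  (Lconn : forall t t', t \in L -> t' \in L -> connect (adjacent L) t t')
  (Lcoh : forall c : {set T} -> 'F_2, (forall t, t \in L -> coboundary c t = 0) ->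
     exists f : T -> 'F_2, forall t e : {set T}, t \in L -> e \subset t ->
       #|e| = 2%N -> c e = \sum_(x in e) f x)
  (AL : A \subset L) (A0 : A != set0)
  (AE : forall x (e : {set T}), x \in cover A -> x \in e -> #|e| = 2%N ->
     cofaces L e != set0 -> #|cofaces L e| = 2%N).

Let N := L :\: A.
(* The triangles of A are their own class; the other classes are the components
   of the complement of A. *)
Let cls := fingraph.root (adjacent N).
Let bd := [set e in edges_of A | #|cofaces A e| == 1%N].

Let adj_sym : connect_sym (adjacent N).
Proof. by apply: sym_connect_sym; exact: adjacent_sym. Qed.

Let cls_connect t : connect (adjacent N) t (cls t).
Proof. exact: connect_root. Qed.

Let connectN t t' : connect (adjacent N) t t' -> t != t' -> (t \in N) && (t' \in N).
Proof.
move=> /connectP[[|y p] /= ]; first by move=> _ ->; rewrite eqxx.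
move=> /andP[/and3P[-> yN _] pp] -> _ /=.
elim: p y yN pp => //= z p IH y yN /andP[/and3P[_ zN _]]; exact: IH.
Qed.

Let cls_A t : t \in A -> cls t = t.
Proof.
move=> tA; apply/eqP; rewrite eq_sym; apply/negPn/negP => /(connectN (cls_connect t)).
by rewrite inE tA.
Qed.

Let cls_N t : t \in N -> cls t \in N.
Proof.
move=> tN; have [<-//|] := eqVneq t (cls t).
by move=> /(connectN (cls_connect t)) /andP[].
Qed.

Let cls_eq t t' : adjacent N t t' -> cls t = cls t'.
Proof. by move=> /connect1 h; apply/eqP; rewrite /cls root_connect. Qed.

Let edgeE e : e \in edges_of A -> #|e| = 2%N /\ #|cofaces L e| = 2%N.
Proof.
rewrite inE => /andP[/eqP e2 /existsP[t /andP[tA et]]]; split=> //.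
have [x xe] : exists x, x \in e by apply/set0Pn; rewrite -card_gt0 e2.
apply: (AE (x := x)) => //; first by apply/bigcupP; exists t => //; exact: (subsetP et).
by apply/set0Pn; exists t; rewrite inE et (subsetP AL).
Qed.

Let edge_sub e : e \in edges_of A -> e \subset cover A.
Proof.
rewrite inE => /andP[_ /existsP[t /andP[tA et]]].
exact: subset_trans et (bigcup_sup _ tA).
Qed.

Let card_edges : (2 * #|edges_of A| = 3 * #|A| + #|bd|)%N.
Proof.
have -> : (3 * #|A| = \sum_(e in edges_of A) #|cofaces A e|)%N.
  transitivity (\sum_(t in A) \sum_(e : {set T} | (e \subset t) && (#|e| == 2)%N) 1)%N.
    rewrite mulnC -sum_nat_const; apply: eq_bigr => t /(subsetP AL) tL.
    rewrite -[LHS](card_pairs_triple (L3 tL)) -sum1_card.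
    by apply: eq_bigl => e; rewrite inE.
  rewrite (exchange_big_dep (mem (edges_of A))) /=; last first.
    move=> t e tA /andP[et e2]; rewrite inE e2; apply/existsP; exists t.
    by rewrite tA.
  apply: eq_bigr => e; rewrite inE => /andP[e2 _]; rewrite -[RHS]sum1_card.
  by apply: eq_bigl => t; rewrite inE e2 andbT.
have -> : #|bd| = (\sum_(e in edges_of A) (#|cofaces A e| == 1))%N.
  rewrite -sum1_card /bd; under eq_bigl do rewrite inE.
  by rewrite big_mkcondr /=; apply: eq_bigr => e _; case: eqP.
rewrite -big_split mulnC -sum_nat_const; apply: eq_bigr => e eE /=.
have [e2 l2] := edgeE eE.
have : (#|cofaces A e| <= 2)%N.
  rewrite -l2; apply/subset_leq_card/subsetP => t; rewrite !inE => /andP[tA ->].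
  by rewrite (subsetP AL).
have : (0 < #|cofaces A e|)%N.
  rewrite card_gt0; move: eE; rewrite inE => /andP[_ /existsP[t /andP[tA et]]].
  by apply/set0Pn; exists t; rewrite inE tA.
by case: (#|cofaces A e|) => [|[|[|]]].
Qed.

Let Nset j := [set e in bd | [exists t in N, (e \subset t) && (cls t == j)]].

Let outer_uniq e t t' : e \in bd -> t \in N -> t' \in N -> e \subset t ->
  e \subset t' -> t = t'.
Proof.
rewrite inE => /andP[eE /eqP e1] tN t'N et et'.
have [_ l2] := edgeE eE.
apply/eqP/negPn/negP => tt'.
have : (#|[set t; t']| <= #|cofaces L e :\: cofaces A e|)%N.
  apply/subset_leq_card/subsetP => u; move: tN t'N; rewrite !inE.
  by move=> /andP[tA tL] /andP[t'A t'L] /orP[] /eqP->; rewrite ?(negPf tA) ?(negPf t'A) ?tL ?t'L ?et ?et'.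
rewrite cards2 tt' cardsD l2 (setIidPr _) ?e1 //.
by apply/subsetP => u; rewrite !inE => /andP[uA ->]; rewrite (subsetP AL).
Qed.

Let NsetP e j : e \in Nset j ->
  e \in bd /\ exists t, [/\ t \in N, e \subset t & cls t = j].
Proof.
by move=> /setIdP[-> /existsP[t /and3P[? ? /eqP ?]]]; split=> //; exists t.
Qed.

Let sum_Nset : (\sum_(j in cls @: N) #|Nset j| <= #|bd|)%N.
Proof.
under eq_bigr => j _ do rewrite -sum1_card.
rewrite (exchange_big_dep (mem bd)) /=; last by move=> j e _; rewrite inE => /andP[].
rewrite -sum1_card; apply: leq_sum => e ebd.
rewrite sum1_card.
rewrite -cardsE; apply/card_le1_eqP => j j'; rewrite !in_set.
move=> /andP[_ ej] /andP[_ ej'].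
have [_ [t [tN et <-]]] := NsetP ej; have [_ [t' [t'N et' <-]]] := NsetP ej'.
by rewrite (outer_uniq ebd tN t'N et et').
Qed.

Let meet_edge (t t' e : {set T}) : #|e| = 2%N -> t \in L -> t' \in L -> t != t' ->
  e \subset t -> e \subset t' -> t :&: t' = e.
Proof.
move=> e2 tL t'L tt' et et'; apply/esym/eqP; rewrite eqEcard subsetI et et' /= e2.
rewrite leqNgt; apply/negP => h.
have := subset_leq_card (subsetIl t t'); rewrite (L3 tL) => h3.
have c3 : #|t :&: t'| = 3%N by apply/eqP; rewrite eqn_leq h h3.
have e1 : t :&: t' = t by apply/eqP; rewrite eqEcard subsetIl c3 (L3 tL).
have e2' : t :&: t' = t' by apply/eqP; rewrite eqEcard subsetIr c3 (L3 t'L).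
by move: tt'; rewrite -e1 -{2}e2' eqxx.
Qed.

(** At a vertex of [A], the edges of [Nset j] are those with an odd number of cofaces in component
    [j]. Indeed an edge there has two cofaces in [L]; if both are outside [A], they are adjacent and
    belong to the same component, so they contribute 0 or 2. Hence [Nset j] behaves like a mod 2
    boundary at such vertices. *)
Let Nset_even j x : j \in cls @: N -> x \in cover A ->
  ~~ odd #|[set e in Nset j | x \in e]|.
Proof.
move=> jJ xA; pose C := [set t in N | cls t == j].
have C3 t : t \in C -> #|t| = 3%N by rewrite !inE => /andP[/andP[_ /L3]].
have := odd_edges_at_even x C3; congr (~~ odd _); apply: eq_card => e.
rewrite !inE; have [xe|] := boolP (x \in e); last by rewrite andbF.
rewrite andbT /=; apply/idP/idP => [/andP[/eqP e2 od]|].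
  have [t] : exists t, t \in cofaces C e.
    by apply/set0Pn; rewrite -card_gt0; case: #|_| od.
  rewrite !inE => /andP[/andP[/andP[tA tL] /eqP ct] et].
  have l2 : #|cofaces L e| = 2%N.
    by apply: (AE xA) => //; apply/set0Pn; exists t; rewrite inE tL.
  have [t' t't Ct'] : exists2 t', t' != t & cofaces L e = [set t; t'].
    have : #|cofaces L e :\ t| = 1%N.
      by move: l2; rewrite (cardsD1 t) inE tL et => -[].
    move=> /eqP/cards1P[t' h]; exists t'; last by rewrite -h setD1K // inE tL.
    by have := set11 t'; rewrite -h !inE => /andP[].
  have [t'L et'] : t' \in L /\ e \subset t'.
    have : t' \in cofaces L e by rewrite Ct' !inE eqxx orbT.
    by rewrite inE => /andP.
  have t'A : t' \in A.
    apply/negPn/negP => t'A; move: od.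
    have ct' : cls t' = j.
      rewrite -ct; apply: cls_eq; rewrite /adjacent !inE tA tL t'A t'L /=.
      by rewrite (meet_edge e2) // e2.
    suff -> : cofaces C e = cofaces L e by rewrite l2.
    apply/setP => u; rewrite Ct' !inE; apply/idP/idP.
      move=> /andP[/andP[/andP[_ uL] _] eu].
      have : u \in cofaces L e by rewrite inE uL.
      by rewrite Ct' !inE.
    by move=> /orP[] /eqP->; rewrite ?tA ?tL ?t'A ?t'L ?ct ?ct' eqxx ?et ?et'.
  have CA : cofaces A e = [set t'].
    apply/setP => u; rewrite !inE; apply/idP/idP => [/andP[uA eu]|/eqP->]; last by rewrite t'A et'.
    have : u \in cofaces L e by rewrite inE (subsetP AL).
    by rewrite Ct' !inE => /orP[/eqP ut|//]; rewrite -ut uA in tA.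
  rewrite e2 eqxx CA cards1 eqxx /= andbT; apply/andP; split.
    by apply/existsP; exists t'; rewrite t'A.
  by apply/existsP; exists t; rewrite !inE tA tL et ct eqxx.
move=> /andP[/andP[/andP[e2 eA] e1] /existsP[t /and3P[tN et ct]]].
rewrite e2 /= (_ : cofaces C e = [set t]) ?cards1 //.
apply/setP => u; rewrite in_set1; apply/idP/idP => [|/eqP->]; last by rewrite !inE in tN *; rewrite tN ct.
rewrite inE => /andP[]; rewrite inE => /andP[uN _] eu; apply/eqP.
by apply: (outer_uniq (e := e)) => //; rewrite !inE e2 eA.
Qed.

(** A path in [L] from the component to [A] crosses a first edge [e] of [Nset j] when it enters [A].
    By parity each end of [e] lies on a further edge of [Nset j], and these two edges differ, since
    one edge containing both ends would be [e]. *)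
Let Nset_ge3 j : j \in cls @: N -> (3 <= #|Nset j|)%N.
Proof.
move=> jJ.
have [e ej] : exists e, e \in Nset j.
  case/imsetP: (jJ) => t0 t0N ej; have [a aA] := set0Pn _ A0.
  have t0L : t0 \in L by move: t0N; rewrite inE => /andP[].
  have /connectP[p pp pa] := Lconn t0L (subsetP AL _ aA).
  have : (t0 \in N) && (cls t0 == j) by rewrite t0N ej eqxx.
  elim: p t0 {ej t0N t0L} pp pa => [|t p IH] t0 /=.
    by move=> _ <-; rewrite inE aA.
  move=> /andP[/and3P[t0L tL m2] pp] pa /andP[t0N ct0].
  have [tA|tA] := boolP (t \in A); last first.
    have tN : t \in N by rewrite inE tA.
    apply: (IH t) => //; rewrite tN -(eqP ct0) eq_sym; apply/eqP/cls_eq.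
    by rewrite /adjacent t0N tN.
  have eE : t0 :&: t \in edges_of A.
    by rewrite inE m2; apply/existsP; exists t; rewrite tA subsetIr.
  exists (t0 :&: t); rewrite inE; apply/andP; split; last first.
    by apply/existsP; exists t0; rewrite t0N subsetIl.
  rewrite inE eE /= (_ : cofaces A _ = [set t]) ?cards1 //.
  have [e2 l2] := edgeE eE.
  have Lt : cofaces L (t0 :&: t) = [set t0; t].
    apply/esym/eqP; rewrite eqEcard l2 cards2 subUset !sub1set !inE t0L tL subsetIl subsetIr /=.
    by case: eqVneq t0N => // ->; rewrite inE tA.
  apply/setP => u; rewrite in_set1; apply/idP/idP => [|/eqP->]; last by rewrite inE tA subsetIr.
  rewrite inE => /andP[uA us]; have : u \in cofaces L (t0 :&: t) by rewrite inE (subsetP AL).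
  rewrite Lt !inE => /orP[/eqP ut|//]; by rewrite -ut inE uA in t0N.
have eE : e \in edges_of A by move: ej; rewrite !inE => /andP[/andP[->]].
have [e2 _] := edgeE eE.
have another x : x \in e -> exists e', [/\ e' \in Nset j, x \in e' & e' != e].
  move=> xe; have := Nset_even jJ (subsetP (edge_sub eE) _ xe).
  rewrite (cardsD1 e) inE ej xe /= negbK => od.
  have [e'] : exists e', e' \in [set e in Nset j | x \in e] :\ e.
    by apply/set0Pn; rewrite -card_gt0; case: #|_| od.
  by rewrite in_setD1 inE => /and3P[? ? ?]; exists e'.
have /cards2P[x [y [xy exy]]] : #|e| == 2%N by rewrite e2.
have [e1 [e1j xe1 e1e]] : exists e', [/\ e' \in Nset j, x \in e' & e' != e].
  by apply: another; rewrite exy !inE eqxx.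
have [e3 [e3j ye3 e3e]] : exists e', [/\ e' \in Nset j, y \in e' & e' != e].
  by apply: another; rewrite exy !inE eqxx orbT.
have e13 : e1 != e3.
  apply: contraNneq e1e => e13; rewrite exy.
  have e1E : e1 \in edges_of A by move: e1j; rewrite !inE => /andP[/andP[->]].
  by apply/eqP/card2_eq => //; [have [] := edgeE e1E|rewrite e13].
apply: leq_trans (subset_leq_card (A := [set e; e1; e3]) _).
  by rewrite setUC cardsU1 cards2 !inE (eq_sym e3 e) !(eq_sym e) ?(negPf e3e) (negPf e1e) (eq_sym e3) (negPf e13).
by rewrite !subUset !sub1set ej e1j e3j.
Qed.

Let card_bd : (3 * #|cls @: N| <= #|bd|)%N.
Proof.
apply: leq_trans sum_Nset; rewrite mulnC -sum_nat_const.
by apply: leq_sum => j jJ; exact: Nset_ge3.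
Qed.

Let J := cls @: L.

Let card_J : #|J| = (#|A| + #|cls @: N|)%N.
Proof.
have -> : J = A :|: cls @: N.
  rewrite /J -{1}(setID L A) (setIidPr AL) imsetU; congr (_ :|: _).
  apply/setP => t; apply/imsetP/idP => [[u uA ->]|tA]; first by rewrite cls_A.
  by exists t; rewrite ?cls_A.
rewrite cardsU (_ : A :&: _ = set0) ?cards0 ?subn0 //.
apply/setP => t; rewrite in_set0; apply/negP; rewrite in_setI => /andP[tA].
by case/imsetP => u /cls_N uN e; move: uN; rewrite -e inE tA.
Qed.

Let coboundaryD (c d : {set T} -> 'F_2) t : coboundary (fun e => c e + d e) t = coboundary c t + coboundary d t.
Proof. exact: big_split. Qed.

Let coboundary_sum (I : finType) (P : pred I) (a : I -> 'F_2)
    (c : I -> {set T} -> 'F_2) t :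
  coboundary (fun e => \sum_(i | P i) a i * c i e) t =
  \sum_(i | P i) a i * coboundary (c i) t.
Proof.
rewrite /coboundary exchange_big; apply: eq_bigr => i _.
by rewrite mulr_sumr.
Qed.

(** The cochain is the sum of the edges crossed by a path of triangles in [N] from [t] to the
    representative of its class. Its coboundary telescopes to the two end triangles. A crossed edge
    already has two cofaces outside [A], so it is not an edge of [A]. *)
Let path_cochain t : t \in N -> exists g : {set T} -> 'F_2,
  (forall e, e \in edges_of A -> g e = 0) /\
  forall s, s \in L -> coboundary g s = (s == t)%:R + (s == cls t)%:R.
Proof.
move=> tN; have /connectP[p pp pc] := cls_connect t; rewrite pc {pc}.
elim: p t tN pp => [|u p IH] t tN /=.
  move=> _; exists (fun=> 0); split=> // s _.
  by rewrite F2_addrr /coboundary big1.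
move=> /andP[/and3P[_ uN /eqP m2] pp].
have [g [gE gL]] := IH u uN pp.
have [tL tA] := setDP tN; have [uL uA] := setDP uN.
have tu : t != u.
  by apply/eqP => tu; move: m2; rewrite tu setIid (L3 uL).
exists (fun e => (e == t :&: u)%:R + g e); split=> [e eE|s sL].
  rewrite gE // addr0; case: eqP => // etu; exfalso.
  move: (eE); rewrite inE => /andP[_ /existsP[w /andP[wA ew]]].
  have [e2 l2] := edgeE eE.
  have : (#|[set t; u; w]| <= #|cofaces L e|)%N.
    apply/subset_leq_card; rewrite !subUset !sub1set !inE tL uL (subsetP AL _ wA) ew.
    by rewrite etu subsetIl subsetIr.
  rewrite l2 setUC cardsU1 cards2 tu !inE.
  by rewrite negb_or (memPn tA w wA) (memPn uA w wA).
rewrite coboundaryD gL // addrA; congr (_ + _).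
have [et|st] := eqVneq s t.
  rewrite et (negPf tu) addr0 /coboundary (bigD1 (t :&: u)) /=; last by rewrite subsetIl m2.
  by rewrite eqxx big1 ?addr0 // => e /andP[_ /negPf->].
have [eu|su] := eqVneq s u.
  rewrite eu /coboundary (bigD1 (t :&: u)) /=; last by rewrite subsetIr m2.
  by rewrite eqxx big1 ?addr0 ?F2_addrr // => e /andP[_ /negPf->].
rewrite addr0 /coboundary big1 // => e /andP[es e2].
case: eqP => // etu; exfalso.
have := L2 m2; rewrite leqNgt => /negP; apply.
have : (#|[set t; u; s]| <= #|cofaces L (t :&: u)|)%N.
  apply/subset_leq_card; rewrite !subUset !sub1set !inE tL uL sL -etu es.
  by rewrite etu subsetIl subsetIr.
by apply: leq_trans; rewrite setUC cardsU1 cards2 tu !inE (negPf st) (negPf su).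
Qed.

(** Only values off the edges of [A] are changed. The coboundary of each triangle outside [A] is
    pushed along its path to the representative of its class, where the total vanishes by
    hypothesis. A triangle of [A] is alone in its class, so there the hypothesis itself says that
    the coboundary is zero. *)
Let extend_cocycle (c : {set T} -> 'F_2) :
  (forall e, e \notin edges_of A -> c e = 0) ->
  (forall j, j \in J -> \sum_(t in L | cls t == j) coboundary c t = 0) ->
  exists2 c', forall t, t \in L -> coboundary c' t = 0 &
    forall e, e \in edges_of A -> c' e = c e.
Proof.
move=> c0 cJ.
have /choice[g Hg] (t : {set T}) : exists g : {set T} -> 'F_2, t \in N ->
    (forall e, e \in edges_of A -> g e = 0) /\
    forall s, s \in L -> coboundary g s = (s == t)%:R + (s == cls t)%:R.
  have [/path_cochain[g gP]|tN] := boolP (t \in N); first by exists g.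
  by exists (fun=> 0).
exists (fun e => c e + \sum_(t in N) coboundary c t * g t e); last first.
  by move=> e eE; rewrite big1 ?addr0 // => t /Hg[-> //]; rewrite mulr0.
move=> s sL; rewrite coboundaryD coboundary_sum.
have -> : \sum_(t in N) coboundary c t * coboundary (g t) s =
    \sum_(t in N) coboundary c t * (s == t)%:R +
    \sum_(t in N) coboundary c t * (s == cls t)%:R.
  by rewrite -big_split; apply: eq_bigr => t /Hg[_ ->] //; rewrite mulrDr.
have pick (P : pred {set T}) (Q : pred {set T}) : \sum_(t | P t) coboundary c t * (Q t)%:R =
    \sum_(t | P t && Q t) coboundary c t.
  rewrite [RHS]big_mkcondr; apply: eq_bigr => t _.
  by case: (Q t); rewrite ?mulr1 ?mulr0.
rewrite !pick; have [sA|sA] := boolP (s \in A).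
  rewrite !big1 ?addr0; last 2 first.
  - by move=> t /andP[/cls_N + /eqP e]; rewrite -e inE sA.
  - by move=> t /andP[+ /eqP e]; rewrite -e inE sA.
  rewrite -(cJ s); last by apply/imsetP; exists s; rewrite ?cls_A.
  rewrite (bigD1 s) /=; last by rewrite sL cls_A // eqxx.
  rewrite big1 ?addr0 // => t /andP[/andP[tL /eqP ct] ts].
  have [tA|tA] := boolP (t \in A); first by rewrite -ct cls_A ?eqxx in ts.
  have : cls t \in N by apply: cls_N; rewrite inE tA.
  by rewrite ct inE sA.
have sN : s \in N by rewrite inE sA.
rewrite (big_pred1 s); last first.
  by move=> t /=; rewrite eq_sym; case: eqP => [->|]; rewrite ?sN ?andbF.
rewrite addrA F2_addrr add0r.
have -> : \sum_(t in N | s == cls t) coboundary c t =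
    \sum_(t in L | cls t == s) coboundary c t.
  apply: eq_bigl => t; rewrite eq_sym inE; case: eqP => [ct|]; rewrite ?andbF // !andbT.
  by have [tA|] := boolP (t \in A); first by rewrite -ct cls_A // tA in sA.
have [/cJ//|sJ] := boolP (s \in J).
rewrite big1 // => t /andP[tL /eqP ct]; case/negP: sJ; rewrite -ct; exact: imset_f.
Qed.

(* Over F_2, cochains of the edges of A that vanish under [M1] extend to cocycles
   of L, hence are coboundaries: the row kernel of [M1] lies in the row space of
   [M0]. Both matrices miss one dimension because each edge has two ends and two
   cofaces. *)
Let M0 : 'M['F_2]_(#|cover A|, #|edges_of A|) :=
  \matrix_(i, j) ((enum_val i : T) \in (enum_val j : {set T}))%:R.

Let M1 : 'M['F_2]_(#|edges_of A|, #|J|) :=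
  \matrix_(i, j) #|[set t in cofaces L (enum_val i : {set T}) | cls t == enum_val j]|%:R.

Let rank_M0 : (\rank M0 < #|cover A|)%N.
Proof.
have V0 : (0 < #|cover A|)%N.
  have [t tA] := set0Pn _ A0; have t3 := L3 (subsetP AL _ tA).
  apply: leq_trans (subset_leq_card (bigcup_sup t tA)); by rewrite t3.
have /mulmx0_rank_max : (const_mx 1 : 'rV['F_2]_#|cover A|) *m M0 = 0.
  apply/rowP => j; rewrite !mxE; under eq_bigr => i _ do rewrite !mxE mul1r.
  rewrite -(big_enum_val (fun x => (x \in enum_val j)%:R)) /=.
  have [e2 _] := edgeE (enum_valP j).
  rewrite -natr_sum F2_natr (_ : (\sum_(x in cover A) _)%N = 2%N) //.
  rewrite -e2 -sum1_card big_mkcond [RHS]big_mkcond; apply: eq_bigr => x _.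
  have := subsetP (edge_sub (enum_valP j)) x.
  by case: (x \in enum_val j) => [->|_]; last by case: ifP.
rewrite rank_rV (_ : const_mx 1 != 0) //.
apply/eqP => /rowP /(_ (Ordinal V0)); rewrite !mxE => /eqP.
by rewrite oner_eq0.
Qed.

Let rank_M1 : (\rank M1 < #|J|)%N.
Proof.
have [t tA] := set0Pn _ A0.
have J0 : (0 < #|J|)%N.
  rewrite card_gt0; apply/set0Pn; exists (cls t); apply: imset_f; exact: (subsetP AL).
have /mulmx0_rank_max : M1 *m (const_mx 1 : 'cV['F_2]_#|J|) = 0.
  apply/colP => i; rewrite !mxE; under eq_bigr => j _ do rewrite !mxE mulr1.
  rewrite -(big_enum_val (fun j => #|[set t in cofaces L (enum_val i) | cls t == j]|%:R)) /=.
  have [_ l2] := edgeE (enum_valP i).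
  rewrite -natr_sum F2_natr (_ : (\sum_(j in J) _)%N = 2%N) // -l2.
  rewrite -[RHS]sum1_card [RHS](partition_big cls (mem J)) /=; last first.
    by move=> u; rewrite inE => /andP[uL _]; exact: imset_f.
  by apply: eq_bigr => j _; rewrite -sum1_card; apply: eq_bigl => u; rewrite !inE.
rewrite -[\rank (const_mx _)]mxrank_tr trmx_const rank_rV (_ : const_mx 1 != 0) ?addn1 //.
apply/eqP => /rowP /(_ (Ordinal J0)); rewrite !mxE => /eqP.
by rewrite oner_eq0.
Qed.

Let ker_M1 : (kermx M1 <= M0)%MS.
Proof.
apply/rV_subP => c /sub_kermxP cM1.
pose C (e : {set T}) : 'F_2 := \sum_(i < #|edges_of A| | enum_val i == e) c 0 i.
have CE i : C (enum_val i) = c 0 i.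
  by rewrite /C (big_pred1 i) // => i'; rewrite /= (inj_eq enum_val_inj).
have C0 e : e \notin edges_of A -> C e = 0.
  by move=> eE; rewrite /C big1 // => i /eqP ie; rewrite -ie enum_valP in eE.
have [|c' c'L c'E] := extend_cocycle C0.
  move=> j jJ; have /rowP /(_ (enum_rank_in jJ j)) := cM1; rewrite !mxE.
  move=> h; rewrite -[RHS]h {h}; under [RHS]eq_bigr => i _ do rewrite mxE enum_rankK_in // -CE.
  rewrite -(big_enum_val (fun e => C e * #|[set t in cofaces L e | cls t == j]|%:R)) /=.
  transitivity (\sum_(t in L | cls t == j) \sum_(e in edges_of A | e \subset t) C e).
    apply: eq_bigr => t /andP[tL _]; rewrite /coboundary big_mkcond [RHS]big_mkcond.
    apply: eq_bigr => e _; have [eE|eE] := boolP (e \in edges_of A).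
      by have [-> _] := edgeE eE; rewrite eqxx andbT.
    by rewrite C0 //; case: ifP.
  rewrite (exchange_big_dep (mem (edges_of A))) /=; last by move=> t e _ /andP[].
  apply: eq_bigr => e eE; rewrite mulr_natr -sumr_const; apply: eq_bigl => t.
  by rewrite eE /= in_set in_set andbAC.
have [f fP] := Lcoh c'L.
have -> : c = (\row_i f (enum_val i)) *m M0; last exact: submxMl.
apply/rowP => j; rewrite !mxE; under eq_bigr => i _ do rewrite !mxE.
rewrite -(big_enum_val (fun x => f x * (x \in enum_val j)%:R)) /=.
have eE := enum_valP j; rewrite -CE -c'E //.
move: (eE); rewrite inE => /andP[/eqP e2 /existsP[t /andP[tA et]]].
rewrite (fP t) //; last exact: (subsetP AL).
rewrite big_mkcond [RHS]big_mkcond; apply: eq_bigr => x _.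
have := subsetP (edge_sub eE) x.
case: (x \in enum_val j) => [->//|_]; first by rewrite mulr1.
by rewrite mulr0 if_same.
Qed.

(** The kernel of [M1] has dimension [#|edges_of A| - \rank M1] and is at most [\rank M0]. The two
    strict rank bounds supply the 2 in [#|edges_of A| <= #|cover A| + #|J| - 2], which becomes 12
    after multiplication by 6. *)
Lemma planar_subcomplex : (12 + 3 * #|A| + #|bd| <= 6 * #|cover A|)%N.
Proof.
have := mxrankS ker_M1; rewrite mxrank_ker => r.
have := card_edges; have := card_J; have := card_bd.
move: rank_M0 rank_M1 r; lia.
Qed.

End PlanarSubcomplex.

(** * Layers of normal triangles *)

Section NormalDiscs.
Context (R : realType) (n : nat) (K : {set {set 'I_n}}) (S : normal_cells R n).
Context (Ktri : simplicial_triangulation K) (Snorm : normal_surface K S)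
  (Sclosed : closed_surface S).
Implicit Types (p q : corner S) (d : {set corner S}) (v w x y z : 'I_n).

(** * Corners, arcs and sides of normal discs *)

Lemma card_edge p : #|edge_of p| = 2%N.
Proof. by case: Snorm => _ /(_ p)[]. Qed.

Lemma edge_in_complex p : edge_of p \in K.
Proof. by case: Snorm => _ /(_ p)[[]]. Qed.

Lemma edge_carrier d p : p \in d -> edge_of p \subset carrier d.
Proof. by move=> pd; apply: (bigcup_sup p). Qed.

Lemma carrier_tetrahedron d : d \in discs S -> carrier d \in tetrahedra K.
Proof. by case: Snorm => _ _ /(_ d) + _ _ => H /H []. Qed.

Lemma card_tetrahedron s : s \in tetrahedra K -> #|s| = 4%N.
Proof. by rewrite inE => /andP[_ /eqP]. Qed.

Lemma face_in_complex s (r : {set 'I_n}) : s \in tetrahedra K -> r \subset s ->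
  r != set0 -> r \in K.
Proof.
case: Ktri => -[_ sub] _ _ _; rewrite inE => /andP[sK _]; exact: sub.
Qed.

Lemma disc_separates d : d \in discs S ->
  exists A, [/\ separates d A, (0 < #|A|)%N & (#|A| <= 2)%N].
Proof. by case: Snorm => _ _ /(_ d) + _ _ => H /H []. Qed.

Lemma separates_edge d A p : separates d A -> p \in d ->
  #|edge_of p :&: A| = 1%N.
Proof.
move=> [As H] pd; apply/eqP; rewrite -[_ == _]/(_ : bool).
have := H _ (edge_carrier pd) (card_edge p).
case: eqP => // _ /eqP; rewrite cards_eq0 => /eqP/setP /(_ p).
by rewrite !inE pd eqxx.
Qed.

Lemma separates_corner d A x y : separates d A -> x \in A -> y \in carrier d ->
  y \notin A -> exists2 p, p \in d & edge_of p = [set x; y].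
Proof.
move=> [As H] xA yd yA; have xy : x != y by apply: contraNneq yA => <-.
have := H [set x; y]; rewrite subUset !sub1set (subsetP As _ xA) yd cards2 xy.
move=> /(_ isT erefl); have -> : [set x; y] :&: A = [set x].
  apply/setP => u; rewrite !inE; have [->|ux] := eqVneq u x; first by rewrite xA.
  by have [->|] := eqVneq u y; first by rewrite (negPf yA).
rewrite cards1 eqxx => /eqP/cards1P[p /setP/(_ p)]; rewrite !inE eqxx => /andP[pd /eqP].
by exists p.
Qed.

Lemma separates_inj d A p q : separates d A -> p \in d -> q \in d ->
  edge_of p = edge_of q -> p = q.
Proof.
move=> [As H] pd qd pq; have := H _ (edge_carrier pd) (card_edge p) => h.
have : (#|[set r in d | edge_of r == edge_of p]| <= 1)%N by rewrite h; case: (_ == _).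
by move/card_le1_eqP; apply; rewrite inE ?pd ?qd -?pq eqxx.
Qed.

Lemma disc_inj d p q : d \in discs S -> p \in d -> q \in d ->
  edge_of p = edge_of q -> p = q.
Proof. by move=> /disc_separates[A [sA _ _]]; exact: separates_inj sA. Qed.

Lemma edge_not_sub d A p : separates d A -> p \in d -> ~~ (edge_of p \subset A).
Proof.
move=> sA pd; apply/negP => /setIidPl eA.
by have := separates_edge sA pd; rewrite eA card_edge.
Qed.

(** A common corner of two disjoint discs would lie strictly on one side of [d]. But its edge has an
    end on each side of [d], and the only corner of [d] on that edge is the point itself. *)
Lemma disc_unique d d' p : d \in discs S -> d' \in discs S ->
  carrier d = carrier d' -> p \in d -> p \in d' -> d = d'.
Proof.
move=> dS d'S cc pd pd'; apply/eqP/negPn/negP => dd'.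
case: Snorm => _ _ _ /(_ d d' dS d'S dd' cc) [A sA H] _.
have [eA|[q [u [qd eq _ _]]]] := H p pd'.
  by move: (edge_not_sub sA pd); rewrite eA.
by rewrite (separates_inj sA qd pd eq) ltxx.
Qed.

Lemma disc_at p s : s \in tetrahedra K -> edge_of p \subset s ->
  exists d, [/\ d \in discs S, p \in d & carrier d = s].
Proof. by case: Snorm => _ _ _ _ [H _]; exact: H. Qed.

Lemma edge_at d A p : separates d A -> p \in d -> exists x y,
  [/\ x \in A, y \notin A, y \in carrier d, x != y & edge_of p = [set x; y]].
Proof.
move=> sA pd; have /eqP/cards1P[x ex] := separates_edge sA pd.
have /setIP[xp xA] : x \in edge_of p :&: A by rewrite ex set11.
have : #|edge_of p :\ x| = 1%N by have := card_edge p; rewrite (cardsD1 x) xp => -[].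
move=> /eqP/cards1P[y ey].
have : y \in edge_of p :\ x by rewrite ey set11.
rewrite !inE => /andP[yx yp]; exists x, y; split=> //.
- apply: contra yx => yA; have : y \in edge_of p :&: A by rewrite !inE /= yA andbT yp.
  by rewrite ex inE.
- by apply: (subsetP (edge_carrier pd)); rewrite inE.
- by rewrite eq_sym.
- by rewrite -ey setD1K.
Qed.

(** In the triangle spanned by [edge_of p] and [z], the ends of [edge_of p] are on different sides
    of [d], so exactly one of them is separated from [z]. The new corner lies on the edge from that
    end to [z]; the next lemma adds uniqueness. *)
Lemma face_corner d p z : d \in discs S -> p \in d -> z \in carrier d ->
  z \notin edge_of p -> exists q w,
  [/\ q \in d, w \in edge_of p & edge_of q = [set w; z]].
Proof.
move=> /disc_separates[A [sA _ _]] pd zd zp.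
have [x [y [xA yA yd xy ep]]] := edge_at sA pd.
have [zA|zA] := boolP (z \in A).
  have [q qd eq] := separates_corner sA zA yd yA.
  by exists q, y; rewrite ep !inE eqxx orbT setUC.
have [q qd eq] := separates_corner sA xA zd zA.
by exists q, x; rewrite ep !inE eqxx.
Qed.

Lemma face_corner_unique d p q q' w w' z : d \in discs S -> p \in d ->
  q \in d -> q' \in d -> w \in edge_of p -> w' \in edge_of p ->
  edge_of q = [set w; z] -> edge_of q' = [set w'; z] -> q = q'.
Proof.
move=> dS pd qd q'd wp w'p eq eq'.
have [A [sA _ _]] := disc_separates dS.
have [x [y [xA yA yd xy ep]]] := edge_at sA pd.
apply: (disc_inj dS qd q'd); rewrite eq eq'.
have wz : w != z by apply: contra_eq_neq (card_edge q) => wz; rewrite eq wz setUid cards1.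
have w'z : w' != z by apply: contra_eq_neq (card_edge q') => w'z; rewrite eq' w'z setUid cards1.
have cross u v : [set u; v] = edge_of q \/ [set u; v] = edge_of q' -> (u \in A) (+) (v \in A).
  move=> uv; have [r rd er] : exists2 r, r \in d & edge_of r = [set u; v].
    by case: uv => ->; [exists q|exists q'].
  have := separates_edge sA rd; have := card_edge r; rewrite er.
  have [->|uv'] := eqVneq u v; first by rewrite setUid cards1.
  have [uA|uA] := boolP (u \in A); have [vA|vA] := boolP (v \in A) => //= _.
    by rewrite (setIidPl _) ?cards2 ?uv' // subUset !sub1set uA.
  move/eqP; rewrite eqn_leq => /andP[_]; rewrite card_gt0 => /set0Pn[t].
  by rewrite !inE => /andP[/orP[] /eqP->]; rewrite ?(negPf uA) ?(negPf vA).
have := cross w z (or_introl (esym eq)); have := cross w' z (or_intror (esym eq')).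
move: wp w'p; rewrite ep !inE => /orP[] /eqP-> /orP[] /eqP->//;
  by rewrite xA (negPf yA); case: (z \in A).
Qed.

Lemma carrier2 p q : carrier [set p; q] = edge_of p :|: edge_of q.
Proof.
have [->|pq] := eqVneq p q; first by rewrite !setUid /carrier big_set1.
by rewrite /carrier big_setU1 ?inE //= big_set1.
Qed.

Lemma card_face (e : {set 'I_n}) z : #|e| = 2%N -> z \notin e -> #|z |: e| = 3%N.
Proof. by move=> e2 ze; rewrite cardsU1 ze e2. Qed.

Lemma arc_of_corners d p q w z : d \in discs S -> p \in d -> q \in d ->
  z \notin edge_of p -> w \in edge_of p -> edge_of q = [set w; z] ->
  p != q /\ [set p; q] \in arcs S /\ carrier [set p; q] = z |: edge_of p.
Proof.
move=> dS pd qd zp wp eq.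
have pq : p != q.
  by apply: contraNneq zp => ->; rewrite eq !inE eqxx orbT.
have cpq : carrier [set p; q] = z |: edge_of p.
  rewrite carrier2 eq; apply/setP => u; rewrite in_setU !in_setU1 !in_set1.
  case: (eqVneq u z) => [->|_]; first by rewrite !orbT.
  by rewrite orbF; case: (eqVneq u w) => [->|]; rewrite ?wp ?orbT ?orbF.
split=> //; split=> //.
rewrite inE cards2 pq /= cpq card_face ?card_edge //=.
by apply/existsP; exists d; rewrite dS subUset !sub1set pd.
Qed.

Lemma arc_neighbour p q : [set p; q] \in arcs S -> p != q -> exists w z,
  [/\ w \in edge_of p, z \notin edge_of p & edge_of q = [set w; z]].
Proof.
rewrite inE carrier2 => /and3P[_ /eqP c3 _] pq.
have := cardsUI (edge_of p) (edge_of q); rewrite c3 !card_edge => h.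
have /eqP/cards1P[w ew] : #|edge_of p :&: edge_of q| = 1%N by lia.
have /setIP[wp wq] : w \in edge_of p :&: edge_of q by rewrite ew set11.
have : #|edge_of q :\ w| = 1%N by have := card_edge q; rewrite (cardsD1 w) wq => -[].
move=> /eqP/cards1P[z ez].
have : z \in edge_of q :\ w by rewrite ez set11.
rewrite in_setD1 => /andP[zw zq]; exists w, z; split=> //; last by rewrite -ez setD1K.
apply/negP => zp; have : z \in edge_of p :&: edge_of q by rewrite in_setI zp zq.
by rewrite ew inE (negPf zw).
Qed.

(** The arcs of [d] at [p] correspond to the two vertices of the tetrahedron off [edge_of p], that
    is, to its two faces containing this edge. *)
Lemma card_arcs_at d p : d \in discs S -> p \in d ->
  #|[set a in arcs S | (a \subset d) && (p \in a)]| = 2%N.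
Proof.
move=> dS pd; pose Q := [set q in d | (p != q) && ([set p; q] \in arcs S)].
have -> : [set a in arcs S | (a \subset d) && (p \in a)] = [set [set p; q] | q in Q].
  apply/setP => a; apply/setIdP/imsetP => [[aS /andP[ad pa]]|[q + ->]].
    have : #|a :\ p| = 1%N by move: aS; rewrite inE => /andP[/eqP]; rewrite (cardsD1 p) pa => -[].
    move=> /eqP/cards1P[q ea].
    have : q \in a :\ p by rewrite ea set11.
    rewrite in_setD1 => /andP[qp qa]; have ea' : a = [set p; q] by rewrite -ea setD1K.
    by exists q => //; rewrite inE (subsetP ad) // -ea' aS eq_sym qp.
  by rewrite inE => /and3P[qd pq ar]; rewrite ar subUset !sub1set pd qd !inE eqxx.
rewrite card_in_imset; last first.
  move=> q q'; rewrite !inE => /and3P[_ pq _] /and3P[_ pq' _] /setP/(_ q).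
  by rewrite !inE eqxx orbT eq_sym (negPf pq) /= => /esym/eqP.
have cd : #|carrier d :\: edge_of p| = 2%N.
  rewrite cardsD (setIidPr (edge_carrier pd)) card_edge.
  by rewrite (card_tetrahedron (carrier_tetrahedron dS)).
rewrite -[RHS]cd -[RHS](card_imset _ (@set1_inj _)).
rewrite -[LHS](card_in_imset (f := fun q => edge_of q :\: edge_of p)).
  apply: eq_card => a; apply/imsetP/imsetP => [[q]|[z]].
    rewrite inE => /and3P[qd pq /arc_neighbour/(_ pq)[w [z [wp zp eq]]]] ->.
    exists z; last first.
      apply/setP => u; rewrite eq in_setD in_set2 in_set1; case: (eqVneq u z) => [->|uz]; first by rewrite zp orbT.
      by rewrite orbF; case: eqVneq => [->|]; rewrite ?wp ?andbF.
    by rewrite in_setD zp (subsetP (edge_carrier qd)) // eq !inE eqxx orbT.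
  rewrite in_setD => /andP[zp zd] ->.
  have [q [w [qd wp eq]]] := face_corner dS pd zd zp.
  have [pq [ar _]] := arc_of_corners dS pd qd zp wp eq.
  exists q; first by rewrite inE qd pq.
  apply/setP => u; rewrite eq in_setD in_set2 in_set1; case: (eqVneq u z) => [->|uz]; first by rewrite zp orbT.
  by rewrite orbF; case: eqVneq => [->|]; rewrite ?wp ?andbF.
move=> q q' /setIdP[qd /andP[pq /arc_neighbour/(_ pq)[w [z [wp zp eq]]]]].
move=> /setIdP[q'd /andP[pq' /arc_neighbour/(_ pq')[w' [z' [w'p z'p eq']]]]] e.
have zz : z = z'.
  have : z \in edge_of q :\: edge_of p by rewrite in_setD zp eq !inE eqxx orbT.
  rewrite e in_setD zp eq' !inE => /orP[/eqP zw|/eqP//].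
  by rewrite zw w'p in zp.
by apply: (face_corner_unique dS pd qd q'd wp w'p eq); rewrite zz.
Qed.

Lemma card_arcs_disc d : d \in discs S ->
  #|[set a in arcs S | a \subset d]| = #|d|.
Proof.
move=> dS; apply/eqP; rewrite -(eqn_pmul2r (m := 2)) // -!sum_nat_const.
have -> : (\sum_(p in d) 2 = \sum_(p in d) \sum_(a in arcs S | (a \subset d) && (p \in a)) 1)%N.
  apply: eq_bigr => p pd; rewrite -(card_arcs_at dS pd) -sum1_card.
  by apply: eq_bigl => a; rewrite inE.
rewrite (exchange_big_dep (fun a => (a \in arcs S) && (a \subset d))) /=; last first.
  by move=> p a _ /and3P[-> ->].
apply/eqP; transitivity (\sum_(a in arcs S | a \subset d) 2)%N.
  by apply: eq_bigl => a; rewrite inE.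
apply: eq_bigr => a /andP[aS ad]; have : #|a| = 2%N by move: aS; rewrite inE => /andP[/eqP].
move=> a2; rewrite -[LHS]a2 -[LHS]sum1_card; apply: eq_bigl => p; rewrite aS ad.
by have := subsetP ad p; case: (p \in a) => [/(_ isT)->|_] /=; rewrite ?andbF ?andbT.
Qed.

Lemma double_card_arcs : (2 * #|arcs S| = \sum_(d in discs S) #|d|)%N.
Proof.
rewrite mulnC -sum_nat_const.
transitivity (\sum_(a in arcs S) \sum_(d in discs S | a \subset d) 1)%N.
  apply: eq_bigr => a aS; rewrite -[LHS](Sclosed aS) -sum1_card.
  by apply: eq_bigl => d; rewrite inE.
rewrite (exchange_big_dep (mem (discs S))) /=; last by move=> a d _ /andP[].
apply: eq_bigr => d dS; rewrite -card_arcs_disc // -sum1_card.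
by apply: eq_bigl => a; rewrite inE dS.
Qed.

Lemma card_disc d A : separates d A -> d \in discs S ->
  #|d| = (#|A| * (4 - #|A|))%N.
Proof.
move=> sA dS; have [As _] := sA.
rewrite -(card_tetrahedron (carrier_tetrahedron dS)).
have -> : (#|carrier d| - #|A| = #|carrier d :\: A|)%N.
  by rewrite cardsD (setIidPr As).
rewrite -cardsX -(card_in_imset (f := @edge_of R n S) (D := d)); last first.
  by move=> p q pd qd; exact: disc_inj dS pd qd.
rewrite -[RHS](card_in_imset (f := fun u => [set u.1; u.2])).
  apply: eq_card => e; apply/imsetP/imsetP => [[p pd ->]|[[x y]]].
    have [x [y [xA yA yd xy ep]]] := edge_at sA pd.
    by exists (x, y); rewrite // in_setX xA in_setD yA.
  rewrite in_setX in_setD /= => /and3P[xA yA yd] ->.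
  by have [p pd ep] := separates_corner sA xA yd yA; exists p.
move=> [x y] [x' y']; rewrite !in_setX !in_setD /= => /and3P[xA yA yd] /and3P[x'A y'A y'd] e.
have xE : x = x'.
  have : x \in [set x'; y'] by rewrite -e !inE eqxx.
  by rewrite !inE => /orP[/eqP//|/eqP xy]; rewrite -xy xA in y'A.
have yE : y = y'.
  have : y \in [set x'; y'] by rewrite -e !inE eqxx orbT.
  by rewrite !inE => /orP[/eqP yx|/eqP//]; rewrite yx x'A in yA.
by rewrite xE yE.
Qed.

Lemma disc_cases d : d \in discs S ->
  (exists2 v, separates d [set v] & #|d| = 3%N) \/
  (exists A, [/\ separates d A, #|A| = 2%N & #|d| = 4%N]).
Proof.
move=> dS; have [A [sA A0 A2]] := disc_separates dS.
have := card_disc sA dS; case EA: #|A| A0 A2 => [|[|[|]]] // _ _ cd.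
  left; have /cards1P[v ev] : #|A| == 1%N by rewrite EA.
  by exists v; rewrite // -ev.
by right; exists A.
Qed.

Lemma separates1_edge d v p : separates d [set v] -> p \in d -> v \in edge_of p.
Proof.
by move=> sv pd; have [x [y [/set1P-> _ _ _ ->]]] := edge_at sv pd; rewrite !inE eqxx.
Qed.

Lemma separates1_carrier d v : separates d [set v] -> v \in carrier d.
Proof. by case; rewrite sub1set. Qed.

Lemma separates1_corner d v w : separates d [set v] -> w \in carrier d -> w != v ->
  exists2 p, p \in d & edge_of p = [set v; w].
Proof.
by move=> sv wd wv; apply: (separates_corner sv) => //; rewrite inE.
Qed.

Lemma exists_avoiding (s r : {set 'I_n}) : #|s| = 4%N -> (#|r| <= 3)%N ->
  exists2 u, u \in s & u \notin r.
Proof.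
move=> s4 r3; have : (0 < #|s :\: r|)%N.
  rewrite cardsD s4 subn_gt0; rewrite ltnS; apply: leq_trans r3.
  exact: subset_leq_card (subsetIr s r).
by rewrite card_gt0 => /set0Pn[u /setDP[us ur]]; exists u.
Qed.

Lemma common_vertex_separates d v : d \in discs S ->
  (forall p, p \in d -> v \in edge_of p) -> separates d [set v].
Proof.
move=> dS dv; have c4 := card_tetrahedron (carrier_tetrahedron dS).
have [[a sa _]|[A [sA A2 _]]] := disc_cases dS.
  suff -> : v = a by [].
  have [b bd bav] : exists2 b, b \in carrier d & b \notin [set a; v].
    by apply: exists_avoiding => //; rewrite cards2; case: (a != v).
  move: bav; rewrite !inE negb_or => /andP[ba bv].
  have [p pd ep] := separates1_corner sa bd ba.
  by move: (dv p pd); rewrite ep !inE eq_sym (eq_sym v b) (negPf bv) orbF => /eqP.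
have [As _] := sA.
have [x [xA xv]] : exists x, x \in A /\ x != v.
  have : (0 < #|A :\ v|)%N by have := cardsD1 v A; rewrite A2; by case: (v \in A); case: #|_ :\ _|.
  by rewrite card_gt0 => /set0Pn[x]; rewrite !inE => /andP[]; exists x.
have [y yd] : exists2 y, y \in carrier d & y \notin v |: A.
  by apply: exists_avoiding => //; rewrite cardsU1 A2; case: (v \notin A).
rewrite !inE negb_or => /andP[yv yA].
have [p pd ep] := separates_corner sA xA yd yA.
by move: (dv p pd); rewrite ep !inE !(eq_sym v) (negPf xv) (negPf yv).
Qed.

Lemma apex_unique d v w : d \in discs S -> separates d [set v] ->
  separates d [set w] -> v = w.
Proof.
move=> dS sv sw; apply/eqP/negPn/negP => vw.
have c4 := card_tetrahedron (carrier_tetrahedron dS).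
have [b bd] : exists2 b, b \in carrier d & b \notin [set v; w].
  by apply: exists_avoiding => //; rewrite cards2 vw.
rewrite !inE negb_or => /andP[bv bw].
have [p pd ep] := separates1_corner sv bd bv.
by have := separates1_edge sw pd; rewrite ep !inE !(eq_sym w) (negPf vw) (negPf bw).
Qed.

(** A triangle having an edge that meets [S] is not in the boundary of [M]. It contains an arc of
    [S], which lies on two discs because [S] is closed; these are in different tetrahedra, since a
    tetrahedron has only one disc through a given corner. *)
Lemma face_two_tetrahedra p z s : s \in tetrahedra K -> edge_of p \subset s ->
  z \in s -> z \notin edge_of p ->
  #|[set s in tetrahedra K | z |: edge_of p \subset s]| = 2%N.
Proof.
move=> sT ps zs zp; have [d [dS pd cd]] := disc_at sT ps.
rewrite -cd in zs.
have [q [w [qd wp eq]]] := face_corner dS pd zs zp.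
have [pq [ar ca]] := arc_of_corners dS pd qd zp wp eq.
apply/eqP; rewrite eqn_leq; apply/andP; split.
  case: Ktri => _ _ H _; apply: H; last by rewrite card_face // card_edge.
  apply: (face_in_complex sT); last by apply/set0Pn; exists z; rewrite !inE eqxx.
  by rewrite -cd subUset sub1set zs edge_carrier.
rewrite -(Sclosed ar) -(card_in_imset (f := @carrier R n S)).
  apply/subset_leq_card/subsetP => t /imsetP[d']; rewrite inE => /andP[d'S ad'] ->.
  rewrite inE carrier_tetrahedron //= -ca.
  apply/bigcupsP => r ra; apply: edge_carrier; exact: (subsetP ad').
move=> d1 d2; rewrite !inE => /andP[d1S a1] /andP[d2S a2] cc.
apply: (disc_unique (p := p)) => //; first apply: (subsetP a1); last apply: (subsetP a2);
  by rewrite !inE eqxx.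
Qed.


(* The number of sheets of S between [v] and [p] on the edge of [p]. *)
Definition depth v p : nat :=
  #|[set q : corner S | (edge_of q == edge_of p) && (pos p 0 v < pos q 0 v)]|.

Lemma pos_sum p v w : v != w -> edge_of p = [set v; w] ->
  pos p 0 v + pos p 0 w = 1.
Proof.
move=> vw ep; case: Snorm => _ /(_ p)[[_ <- _] _] _ _ _.
rewrite (bigD1 v) //= (bigD1 w) 1?eq_sym //= big1 ?addr0 // => i /andP[iv iw].
have : i \notin edge_of p by rewrite ep in_set2 negb_or iv iw.
by rewrite inE negbK => /eqP.
Qed.

Lemma pos_inj p q v : edge_of p = edge_of q -> v \in edge_of p ->
  pos p 0 v = pos q 0 v -> p = q.
Proof.
move=> pq vp pv; case: (Snorm) => inj _ _ _ _; apply: inj.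
have : #|edge_of p :\ v| = 1%N by have := card_edge p; rewrite (cardsD1 v) vp => -[].
move=> /eqP/cards1P[w ew].
have ep : edge_of p = [set v; w] by rewrite -ew setD1K.
have vw : v != w.
  have : w \in edge_of p :\ v by rewrite ew set11.
  by rewrite in_setD1 eq_sym => /andP[].
apply/rowP => i; have [->//|iv] := eqVneq i v.
have [->|iw] := eqVneq i w.
  have := pos_sum vw ep; rewrite pv; rewrite pq in ep.
  by rewrite -(pos_sum vw ep) => /addrI.
have ip : i \notin edge_of p by rewrite ep in_set2 negb_or iv iw.
have : i \notin edge_of q by rewrite -pq.
by move: ip; rewrite !inE !negbK => /eqP-> /eqP->.
Qed.

Lemma depth_lt v p q : edge_of p = edge_of q -> pos p 0 v < pos q 0 v ->
  (depth v q < depth v p)%N.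
Proof.
move=> pq lt; apply: proper_card; apply/properP; split.
  by apply/subsetP => r; rewrite !in_set pq => /andP[-> /(lt_trans lt)].
by exists q; rewrite !in_set ?pq eqxx ?ltxx.
Qed.

Lemma depth_inj v p q : edge_of p = edge_of q -> v \in edge_of p ->
  depth v p = depth v q -> p = q.
Proof.
move=> pq vp ipq; apply: (pos_inj pq vp).
case: (ltgtP (pos p 0 v) (pos q 0 v)) => // lt.
  by have := depth_lt pq lt; rewrite ipq ltnn.
by have := depth_lt (esym pq) lt; rewrite ipq ltnn.
Qed.

(** The component of the tetrahedron cut off by the triangle [d] at [v] meets only the three edges
    at [v]. A disc through a point of it stays in it by disjointness, hence is again a triangle
    around [v]. *)
Lemma nested_disc d v p q : d \in discs S -> separates d [set v] -> p \in d ->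
  edge_of q = edge_of p -> pos p 0 v < pos q 0 v ->
  exists d', [/\ d' \in discs S, carrier d' = carrier d, q \in d',
    separates d' [set v] & forall x : corner S, x \in d' -> exists y : corner S,
      [/\ y \in d, edge_of y = edge_of x & pos y 0 v < pos x 0 v]].
Proof.
move=> dS sv pd qp lt.
have qd : edge_of q \subset carrier d by rewrite qp edge_carrier.
have [d' [d'S qd' cd']] := disc_at (carrier_tetrahedron dS) qd.
have vp := separates1_edge sv pd.
have dd' : d != d'.
  apply: contraTneq lt => e; rewrite -e in qd'.
  by rewrite (disc_inj dS pd qd' (esym qp)) ltxx.
case: (Snorm) => _ _ _ /(_ d d' dS d'S dd' (esym cd')) [A sA side] _.
(* If [v] were on the other side, [q] would be nearer than [p] to the other end [u] of the edge. It
   is also nearer to [v], and the two coordinates sum to 1. *)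
have vA : v \in A.
  have [/subsetP/(_ v)|[q0 [u [q0d eq0 uA uq ltu]]]] := side q qd'.
    by apply; rewrite qp.
  apply/negPn/negP => vA; have uv : v != u by apply: contraNneq vA => ->.
  have e0 : q0 = p by apply: (disc_inj dS) => //; rewrite eq0.
  have ep : edge_of p = [set v; u] by apply: card2_eq => //; rewrite ?card_edge -?qp.
  have := pos_sum uv ep; rewrite qp in eq0.
  have := pos_sum uv (etrans qp ep); rewrite e0 in ltu; lra.
have Av : A = [set v].
  apply/setP => u; rewrite in_set1; apply/idP/eqP => [uA|->//].
  apply/eqP/negPn/negP => uv; have [As _] := sA.
  have [r rd er] := separates1_corner sv (subsetP As _ uA) uv.
  by case/negP: (edge_not_sub sA rd); rewrite er subUset !sub1set vA.
have below (x : corner S) : x \in d' -> exists y : corner S,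
    [/\ y \in d, edge_of y = edge_of x & pos y 0 v < pos x 0 v].
  move=> xd'; have [|[y [u [yd ey + _ ltu]]]] := side x xd'.
    by rewrite Av => /subset_leq_card; rewrite card_edge cards1.
  by rewrite Av => /set1P uv; exists y; rewrite -uv.
exists d'; split=> //; apply: common_vertex_separates => // x /below[y [yd <- _]].
exact: separates1_edge sv yd.
Qed.

(** Each sheet between [v] and [p] continues through the tetrahedron as a triangle nested inside
    [d], which meets the edge of [q] between [v] and [q]. Disjoint discs share no corner, so this
    map of sheets is injective. *)
Lemma depth_leq d v p q : d \in discs S -> separates d [set v] -> p \in d ->
  q \in d -> (depth v p <= depth v q)%N.
Proof.
move=> dS sv pd qd.
pose P (x y : corner S) := [/\ edge_of y = edge_of q, pos q 0 v < pos y 0 v & exists d',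
  [/\ d' \in discs S, carrier d' = carrier d, x \in d' & y \in d']].
have /choice[f fP] (x : corner S) : exists y : corner S, edge_of x = edge_of p /\ pos p 0 v < pos x 0 v -> P x y.
  have [[xp px]|h] := pselect (edge_of x = edge_of p /\ pos p 0 v < pos x 0 v); last by exists x.
  have [d' [d'S cd' xd' sv' below]] := nested_disc dS sv pd xp px.
  have vq := separates1_edge sv qd.
  have [w wq] : exists w, edge_of q = [set v; w] /\ w != v.
    have [a [w [/set1P-> wv _ _ ->]]] := edge_at sv qd.
    by exists w; split=> //; rewrite in_set1 in wv.
  case: wq => eq wv.
  have wd : w \in carrier d' by rewrite cd' (subsetP (edge_carrier qd)) // eq !inE eqxx orbT.
  have [y yd' ey] := separates1_corner sv' wd wv.
  have [z [zd ez zy]] := below y yd'.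
  exists y => _; split; [by rewrite ey eq| |by exists d'].
  by rewrite -(disc_inj dS zd qd) // ez ey eq.
rewrite /depth -[X in (X <= _)%N](card_in_imset (f := f)).
  apply/subset_leq_card/subsetP => y /imsetP[x]; rewrite inE => /andP[/eqP xp px] ->.
  by have [h1 h2 _] := fP x (conj xp px); rewrite inE h1 eqxx.
move=> x x'; rewrite !in_set => /andP[/eqP xp px] /andP[/eqP x'p px'] ff.
have [_ _ [d1 [d1S c1 xd1 yd1]]] := fP x (conj xp px).
have [_ _ [d2 [d2S c2 xd2 yd2]]] := fP x' (conj x'p px').
rewrite ff in yd1; have d12 := disc_unique d1S d2S (etrans c1 (esym c2)) yd1 yd2.
by rewrite -d12 in xd2; apply: (disc_inj d1S) => //; rewrite xp.
Qed.

Lemma depth_const d v p q : d \in discs S -> separates d [set v] -> p \in d ->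
  q \in d -> depth v p = depth v q.
Proof.
by move=> dS sv pd qd; apply/eqP; rewrite eqn_leq !(depth_leq dS sv).
Qed.

(** * Layers as subcomplexes of the link of a vertex *)

Definition layer v (i : nat) : {set {set corner S}} :=
  [set d in discs S | `[< separates d [set v] >] && [forall p in d, depth v p == i]].

Definition layer_link v i : {set {set 'I_n}} := [set carrier d :\ v | d in layer v i].

Definition link v : {set {set 'I_n}} :=
  [set s :\ v | s in [set s in tetrahedra K | v \in s]].

Lemma layerP v i d : d \in layer v i <->
  [/\ d \in discs S, separates d [set v] & forall p, p \in d -> depth v p = i].
Proof.
rewrite inE; split=> [/and3P[dS /asboolP sv /forall_inP H]|[dS sv H]].
  by split=> // p /H/eqP.
by apply/and3P; split=> //; [exact/asboolP|apply/forall_inP => p /H ->].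
Qed.

Lemma layer_depth d v p : d \in discs S -> separates d [set v] -> p \in d ->
  d \in layer v (depth v p).
Proof.
by move=> dS sv pd; apply/layerP; split=> // q qd; exact: depth_const qd pd.
Qed.

Lemma layer_corner d v i p : d \in layer v i -> v \in edge_of p ->
  edge_of p \subset carrier d -> depth v p = i -> p \in d.
Proof.
move=> /layerP[dS sv H] vp pd ip.
have [w wp wv] : exists2 w, w \in edge_of p & w != v.
  have : #|edge_of p :\ v| = 1%N by have := card_edge p; rewrite (cardsD1 v) vp => -[].
  move=> /eqP/cards1P[w ew]; have : w \in edge_of p :\ v by rewrite ew set11.
  by rewrite in_setD1 => /andP[wv wp]; exists w.
have ep : edge_of p = [set v; w] by apply: card2_eq; rewrite ?card_edge // eq_sym.
have [q qd eq] := separates1_corner sv (subsetP pd _ wp) wv.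
have -> // : p = q by apply: (depth_inj (v := v)) => //; [rewrite ep eq|rewrite ip H].
Qed.

(** Edge and depth determine a corner, so two triangles of a layer in the same tetrahedron share a
    corner and coincide. *)
Lemma layer_carrier_inj v i : {in layer v i &, injective (fun d => carrier d :\ v)}.
Proof.
move=> d d' dl d'l e; have [dS sv H] := (layerP _ _ _).1 dl.
have [d'S sv' H'] := (layerP _ _ _).1 d'l.
have cc : carrier d = carrier d'.
  by rewrite -(setD1K (separates1_carrier sv)) e setD1K ?separates1_carrier.
have [p pd] : exists p, p \in d.
  apply/set0Pn; rewrite -card_gt0 (card_disc sv dS) cards1 //.
apply: (disc_unique (p := p)) => //; apply: (layer_corner d'l); last exact: H.
  exact: separates1_edge pd.
by rewrite -cc edge_carrier.
Qed.

Lemma card_layer_link v i : #|layer_link v i| = #|layer v i|.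
Proof. by rewrite card_in_imset //; exact: layer_carrier_inj. Qed.

Lemma linkP v t : t \in link v <->
  v \notin t /\ v |: t \in tetrahedra K.
Proof.
split=> [/imsetP[s]|[vt tT]].
  by rewrite inE => /andP[sT vs] ->; rewrite setD11 setD1K.
apply/imsetP; exists (v |: t); first by rewrite inE tT setU11.
by rewrite setU1K.
Qed.

Lemma layer_link_sub v i : layer_link v i \subset link v.
Proof.
apply/subsetP => t /imsetP[d /layerP[dS sv _] ->]; apply/linkP.
by rewrite setD11 setD1K ?carrier_tetrahedron ?separates1_carrier.
Qed.

Lemma card_link v t : t \in link v -> #|t| = 3%N.
Proof.
by move=> /linkP[vt /card_tetrahedron]; rewrite cardsU1 vt => -[].
Qed.

Lemma cofaces_link v (e : {set 'I_n}) :  v \notin e ->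
  #|cofaces (link v) e| = #|[set s in tetrahedra K | v |: e \subset s]|.
Proof.
move=> ve; rewrite -[RHS](card_in_imset (f := fun s => s :\ v)).
  apply: eq_card => t; apply/setIdP/imsetP => [[/linkP[vt tT] et]|[s]].
    exists (v |: t); last by rewrite setU1K.
    by rewrite inE tT setUS.
  rewrite inE subUset sub1set => /and3P[sT vs es] ->.
  split; first by apply/linkP; rewrite setD11 setD1K.
  by rewrite subsetD1 es.
move=> s s'; rewrite !inE !subUset !sub1set => /and3P[_ vs _] /and3P[_ vs' _] ss.
by rewrite -(setD1K vs) ss setD1K.
Qed.

Lemma cofaces_link_le2 v (e : {set 'I_n}) : #|e| = 2%N ->
  (#|cofaces (link v) e| <= 2)%N.
Proof.
move=> e2; have [->|[t]] := set_0Vmem (cofaces (link v) e); first by rewrite cards0.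
rewrite inE => /andP[/linkP[vt tT] et].
have ve : v \notin e by apply: contra vt; exact: (subsetP et).
rewrite cofaces_link //; case: Ktri => _ _ H _; apply: H; last exact: card_face.
by apply: (face_in_complex tT); [rewrite setUS|apply/set0Pn; exists v; rewrite setU11].
Qed.

(** A chain of tetrahedra sharing triangles at [v] becomes a chain of link triangles sharing edges
    when [v] is deleted. *)
Lemma link_connected v t t' : t \in link v -> t' \in link v ->
  connect (adjacent (link v)) t t'.
Proof.
move=> /linkP[vt tT] /linkP[vt' t'T].
have vK : [set v] \in K.
  apply: (face_in_complex tT); first by rewrite sub1set setU11.
  by apply/set0Pn; exists v; rewrite set11.
case: Ktri => _ _ _ /(_ _ _ _ vK tT t'T); rewrite !sub1set !setU11 => /(_ isT isT).
case/connectP => p pp e; rewrite -(setU1K vt) -(setU1K vt') e.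
move: pp {tT t'T vt vt' e}; elim: p (v |: t) => //= u p IH s /andP[/and4P[sT uT vsu su3] pp].
move: vsu; rewrite sub1set in_setI => /andP[vs vu].
apply: connect_trans (IH u pp); apply: connect1; rewrite /adjacent.
apply/and3P; split; try by apply/linkP; rewrite setD11 setD1K.
rewrite (_ : (s :\ v) :&: (u :\ v) = (s :&: u) :\ v); last by rewrite setDIl.
by move: su3; rewrite (cardsD1 v) in_setI vs vu eqSS.
Qed.

Lemma layer_link_interior v i x (e : {set 'I_n}) : x \in cover (layer_link v i) ->
  x \in e -> #|e| = 2%N -> cofaces (link v) e != set0 ->
  #|cofaces (link v) e| = 2%N.
Proof.
move=> /bigcupP[t /imsetP[d dl ->]] /setD1P[xv xd] xe e2.
have [dS sv _] := (layerP _ _ _).1 dl.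
case/set0Pn => t'; rewrite inE => /andP[/linkP[vt' t'T] et'].
have ve : v \notin e by apply: contra vt'; exact: (subsetP et').
have [p pd ep] := separates1_corner sv xd xv.
have : #|e :\ x| = 1%N by move: e2; rewrite (cardsD1 x) xe => -[].
move=> /eqP/cards1P[y ey].
have : y \in e :\ x by rewrite ey set11.
rewrite in_setD1 => /andP[yx ye].
have ee : v |: e = y |: edge_of p.
  by rewrite ep -(setD1K xe) ey setUA setUC.
rewrite cofaces_link // ee.
have sub : v |: e \subset v |: t' by rewrite setUS.
apply: (face_two_tetrahedra t'T).
- by apply: subset_trans sub; rewrite ee subsetUr.
- by apply: (subsetP sub); rewrite ee setU11.
- by rewrite ep in_set2 negb_or yx andbT; apply: contraNneq ve => <-.
Qed.


Lemma coboundary_triple (c : {set 'I_n} -> 'F_2) x y z : x != y -> y != z -> x != z ->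
  coboundary c [set x; y; z] = c [set x; y] + c [set y; z] + c [set x; z].
Proof.
move=> xy yz xz.
have t3 : #|[set x; y; z]| = 3%N.
  by rewrite setUC cardsU1 cards2 xy !inE negb_or !(eq_sym z) xz yz.
have n1 : [set x; y] != [set y; z].
  by apply/eqP => /setP/(_ x); rewrite !inE eqxx (negPf xy) (negPf xz).
have n2 : [set x; y] != [set x; z].
  by apply/eqP => /setP/(_ y); rewrite !inE eqxx orbT (eq_sym y x) (negPf xy) (negPf yz).
have n3 : [set y; z] != [set x; z].
  by apply/eqP => /setP/(_ y); rewrite !inE eqxx (eq_sym y x) (negPf xy) (negPf yz).
have E : [set e : {set 'I_n} | (e \subset [set x; y; z]) && (#|e| == 2%N)] =
    [set [set x; y]; [set y; z]; [set x; z]].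
  apply/esym/eqP; rewrite eqEcard (card_pairs_triple t3); apply/andP; split.
    apply/subsetP => e; rewrite !inE -orbA => /or3P[] /eqP->;
      by rewrite cards2 ?xy ?yz ?xz subUset !sub1set !inE !eqxx ?orbT.
  by rewrite setUC cardsU1 cards2 n1 !inE negb_or !(eq_sym [set x; z]) n2 n3.
transitivity (\sum_(e in [set [set x; y]; [set y; z]; [set x; z]]) c e).
  by rewrite -E; apply: eq_bigl => e; rewrite inE.
rewrite setUC big_setU1; last by rewrite !inE negb_or !(eq_sym [set x; z]) n2 n3.
by rewrite big_setU1 ?inE //= big_set1 addrC.
Qed.

Lemma link_cocycle v (c : {set 'I_n} -> 'F_2) : manifold3 (realization (R := R) K) ->
  (forall t, t \in link v -> coboundary c t = 0) ->
  exists f : 'I_n -> 'F_2, forall t e : {set 'I_n}, t \in link v -> e \subset t ->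
    #|e| = 2%N -> c e = \sum_(x in e) f x.
Proof.
move=> Kman cL.
have [L0|[t0 /linkP[vt0 t0T]]] := set_0Vmem (link v).
  by exists (fun=> 0) => t e; rewrite L0 inE.
have vK : [set v] \in K.
  apply: (face_in_complex t0T); first by rewrite sub1set setU11.
  by apply/set0Pn; exists v; rewrite set11.
have F2b (a : 'F_2) : a = (a != 0)%:R.
  by apply/val_inj; case: a => -[|[|]].
have F2add (a b : bool) : (a (+) b)%:R = a%:R + b%:R :> 'F_2.
  by case: a; case: b; rewrite /= ?F2_addrr ?addr0 ?add0r.
have F2inj (a b : bool) : a%:R = b%:R :> 'F_2 -> a = b by case: a; case: b.
pose c' x y := (x != y) && (c [set x; y] != 0).
have [|w|x y|x y z c4 xyzK|f Hf] := link_cohomology (c := c') _ Kman vK.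
- by case: Ktri.
- by rewrite /c' eqxx.
- by rewrite /c' eq_sym setUC.
- have : uniq [:: v; x; y; z].
    by apply/card_uniqP; rewrite /= -[RHS]c4; apply: eq_card => u; rewrite !inE -!orbA.
  rewrite /= !inE !negb_or !andbT -!andbA => /and5P[vx vy vz xy /andP[xz yz]].
  rewrite /c' xy yz xz /=; apply: F2inj; rewrite F2add -!F2b.
  have /cL : [set x; y; z] \in link v.
    by apply/linkP; rewrite !inE !negb_or vx vy vz !setUA xyzK c4.
  rewrite coboundary_triple // => h.
  by rewrite -[LHS]addr0 -(F2_addrr (c [set x; z])) addrA h add0r.
exists (fun x => (f x)%:R) => t e /linkP[vt tT] et /eqP/cards2P[x [y [xy exy]]].
have [xt yt] : x \in t /\ y \in t.
  by split; apply: (subsetP et); rewrite exy !inE eqxx ?orbT.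
rewrite exy big_setU1 ?inE //= big_set1 -F2add -Hf.
- by rewrite /c' xy /= -F2b.
- by apply: contraNneq vt => <-.
- by apply: contraNneq vt => <-.
- apply: (face_in_complex tT).
    by rewrite !subUset !sub1set setU11 !inE xt yt !orbT.
  by apply/set0Pn; exists v; rewrite !inE eqxx.
Qed.

(** * The rim of a layer and the adjacent quadrilaterals *)

Definition rim v i : {set {set 'I_n}} :=
  [set e in edges_of (layer_link v i) | #|cofaces (layer_link v i) e| == 1%N].

Lemma layer_bound v i : manifold3 (realization (R := R) K) -> layer v i != set0 ->
  (12 + 3 * #|layer v i| + #|rim v i| <= 6 * #|cover (layer_link v i)|)%N.
Proof.
move=> Kman l0; rewrite -card_layer_link; apply: (planar_subcomplex (L := link v)).
- exact: card_link.
- exact: cofaces_link_le2.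
- exact: link_connected.
- by move=> c; exact: link_cocycle.
- exact: layer_link_sub.
- case/set0Pn: l0 => d dl; apply/set0Pn; exists (carrier d :\ v); exact: imset_f.
- exact: layer_link_interior.
Qed.

Lemma rim_mem v i (e t t' : {set 'I_n}) : #|e| = 2%N -> t \in layer_link v i -> t' \in link v ->
  t' \notin layer_link v i -> e \subset t -> e \subset t' -> e \in rim v i.
Proof.
move=> e2 tA t'L t'A et et'.
have eE : e \in edges_of (layer_link v i).
  by rewrite inE e2 eqxx; apply/existsP; exists t; rewrite tA.
rewrite inE eE /= eqn_leq; apply/andP; split; last first.
  by rewrite card_gt0; apply/set0Pn; exists t; rewrite inE tA.
rewrite -ltnS; apply: leq_trans (cofaces_link_le2 v e2).
apply: proper_card; apply/properP; split.
  by apply/subsetP => u /setIdP[/(subsetP (layer_link_sub v i)) ? ?]; apply/setIdP.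
by exists t'; rewrite inE ?t'L // (negPf t'A).
Qed.

Definition capped v p : bool :=
  [exists d in discs S, (p \in d) && `[< separates d [set v] >]].

Lemma cappedP v p : reflect
  (exists d, [/\ d \in discs S, p \in d & separates d [set v]]) (capped v p).
Proof.
apply: (iffP exists_inP) => [[d dS /andP[pd /asboolP sv]]|[d [dS pd sv]]].
  by exists d.
by exists d => //; rewrite pd; exact/asboolP.
Qed.

(** The tetrahedra around [edge_of p] form a chain from the one with the triangle at [v] to the one
    with the triangle at [w]. The latter is not in the layer, because its disc through [p] cuts off
    [w]. Where the chain leaves the layer there is a rim edge at [w]; the number of rim edges at [w]
    is even, so there are two. *)
Lemma rim_at p v w : v != w -> edge_of p = [set v; w] -> capped v p -> capped w p ->
  (2 <= #|[set e in rim v (depth v p) | w \in e]|)%N.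
Proof.
move=> vw ep /cappedP[dv [dvS pdv sv]] /cappedP[dw [dwS pdw sw]].
set i := depth v p; set A := layer_link v i.
have dvl : dv \in layer v i by exact: layer_depth.
have ev : ~~ odd #|[set e in rim v i | w \in e]|.
  have A3 t : t \in A -> #|t| = 3%N by move/(subsetP (layer_link_sub v i)); exact: card_link.
  have := odd_edges_at_even w A3; congr (~~ odd _); apply: eq_card => e.
  rewrite !in_set -/A; case: (w \in e); rewrite ?andbF //= andbT -andbA.
  case: eqP => //= e2.
  have le2 : (#|cofaces A e| <= 2)%N.
    apply: leq_trans (cofaces_link_le2 v e2); apply/subset_leq_card/subsetP => u.
    by move=> /setIdP[/(subsetP (layer_link_sub v i)) ? ?]; apply/setIdP.
  have -> : [exists t in A, e \subset t] = (0 < #|cofaces A e|)%N.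
    rewrite card_gt0; apply/exists_inP/set0Pn => [[t tA et]|[t]].
      by exists t; rewrite inE tA.
    by rewrite inE => /andP[]; exists t.
  by case: #|_| le2 => [|[|[]]].
suff : (0 < #|[set e in rim v i | w \in e]|)%N by case: #|_| ev => [|[]].
rewrite card_gt0; apply/set0Pn.
have eK := edge_in_complex p.
case: (Ktri) => _ _ _ /(_ _ _ _ eK (carrier_tetrahedron dvS) (carrier_tetrahedron dwS)).
move=> /(_ (edge_carrier pdv) (edge_carrier pdw)) /connectP[q qp qe].
have : carrier dv :\ v \in A by exact: imset_f.
have last_out : carrier dw :\ v \notin A.
  apply/imsetP => -[d dl cc]; have [dS sv' _] := (layerP _ _ _).1 dl.
  have vdw : v \in carrier dw by apply: (subsetP (edge_carrier pdw)); rewrite ep !inE eqxx.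
  have cd : carrier d = carrier dw.
    by rewrite -(setD1K (separates1_carrier sv')) -cc setD1K.
  have pd : p \in d.
    apply: (layer_corner dl) => //; first by rewrite ep !inE eqxx.
    by rewrite cd edge_carrier.
  have dd := disc_unique dS dwS cd pd pdw; rewrite dd in sv'.
  by move: vw; rewrite (apex_unique dwS sv' sw) eqxx.
move: last_out; rewrite qe.
elim: q (carrier dv) qp {qe} => [|t q IH] s /=; first by move=> _ /negPf->.
move=> /andP[/and4P[sT tT]]; rewrite ep subUset !sub1set !in_setI.
move=> /andP[/andP[vs vt] /andP[ws wt]] /eqP st3 qp qA sA.
have [tA|tA] := boolP (t :\ v \in A); first by apply: (IH t); rewrite ?ep.
have e2 : #|(s :&: t) :\ v| = 2%N.
  by move: st3; rewrite (cardsD1 v) in_setI vs vt => -[].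
exists ((s :&: t) :\ v); rewrite in_set; apply/andP; split.
  apply: (rim_mem (t := s :\ v) (t' := t :\ v)) => //.
  - by apply/linkP; rewrite setD11 setD1K.
  - by rewrite setSD // subsetIl.
  - by rewrite setSD // subsetIr.
by rewrite in_setD1 eq_sym vw in_setI ws.
Qed.

(** The arc of the layer facing [e] lies on a second disc. If that were a triangle, its apex would
    be the common end [v] of the two edges, so it would belong to the same layer and give [e] a
    second coface there. *)
Lemma quad_across_rim p v w (e : {set 'I_n}) : v != w -> edge_of p = [set v; w] ->
  e \in rim v (depth v p) -> w \in e ->
  exists d q z, [/\ d \in discs S, #|d| = 4%N, p \in d, q \in d &
    e = [set w; z] /\ edge_of q = [set v; z]].
Proof.
move=> vw ep; rewrite in_set => /andP[]; rewrite in_set => /andP[/eqP e2].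
move=> /exists_inP[t /imsetP[d1 d1l ->]] ed1 c1 we.
have [d1S sv _] := (layerP _ _ _).1 d1l.
have e_sub : e \subset carrier d1 by apply: subset_trans ed1 (subsetDl _ _).
have ve : v \notin e by apply/negP => /(subsetP ed1); rewrite setD11.
have : #|e :\ w| = 1%N by move: e2; rewrite (cardsD1 w) we => -[].
move=> /eqP/cards1P[z ez]; have ewz : e = [set w; z] by rewrite -ez setD1K.
have ze : z \in e by rewrite ewz !inE eqxx orbT.
have : z \in e :\ w by rewrite ez set11.
rewrite in_setD1 => /andP[zw _].
have zv : z != v by apply: contraNneq ve => <-.
have vp : v \in edge_of p by rewrite ep !inE eqxx.
have pd1 : p \in d1.
  apply: (layer_corner d1l) => //; rewrite ep subUset !sub1set.
  by rewrite (separates1_carrier sv) (subsetP e_sub).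
have [q qd1 eq] := separates1_corner sv (subsetP e_sub _ ze) zv.
have zp : z \notin edge_of p by rewrite ep in_set2 negb_or zv.
have [pq [ar ca]] := arc_of_corners d1S pd1 qd1 zp vp eq.
have : (0 < #|[set d in discs S | [set p; q] \subset d] :\ d1|)%N.
  have := Sclosed ar; rewrite (cardsD1 d1) in_set d1S subUset !sub1set pd1 qd1.
  by case: #|_ :\ _|.
rewrite card_gt0 => /set0Pn[d]; rewrite in_setD1 in_set subUset !sub1set.
move=> /and3P[dd1 dS /andP[pd qd]]; exists d, q, z; split=> //.
have [[a sa _]|[A [_ _ ->]]] := disc_cases dS; last by [].
exfalso; have av : a = v.
  have := separates1_edge sa pd; have := separates1_edge sa qd.
  rewrite ep eq !in_set2 => /orP[/eqP->//|/eqP->] /orP[/eqP->//|].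
  by rewrite (negPf zw).
rewrite av in sa.
have dl : d \in layer v (depth v p) by exact: layer_depth.
have cc : carrier d != carrier d1.
  by apply: contraNneq dd1 => cc; apply/eqP/(disc_unique dS d1S cc pd).
have cfd : carrier d :\ v \in cofaces (layer_link v (depth v p)) e.
  apply/setIdP; split; first exact: imset_f.
  rewrite subsetD1 ve andbT ewz subUset !sub1set.
  rewrite (subsetP (edge_carrier pd)) ?ep ?in_set2 ?eqxx ?orbT //=.
  by rewrite (subsetP (edge_carrier qd)) // eq in_set2 eqxx orbT.
have cfd1 : carrier d1 :\ v \in cofaces (layer_link v (depth v p)) e.
  by apply/setIdP; split; first exact: imset_f.
have /card_le1_eqP one : (#|cofaces (layer_link v (depth v p)) e| <= 1)%N.
  by rewrite (eqP c1).
apply/negP: cc; rewrite negbK -(setD1K (separates1_carrier sa)).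
by rewrite (one _ _ cfd1 cfd) setD1K ?separates1_carrier.
Qed.

(** Different rim edges at [w] give different quadrilaterals: a disc with corners on three edges at
    [v] separates [v] from the other three vertices, which no quadrilateral does. *)
Lemma rim_at_le_quads p v w : v != w -> edge_of p = [set v; w] ->
  (#|[set e in rim v (depth v p) | w \in e]| <=
   #|[set d in discs S | (#|d| == 4%N) && (p \in d)]|)%N.
Proof.
move=> vw ep.
pose P (e : {set 'I_n}) (d : {set corner S}) := exists q z,
  [/\ d \in discs S, #|d| = 4%N, p \in d, q \in d &
    e = [set w; z] /\ edge_of q = [set v; z]].
have /choice[f fP] (e : {set 'I_n}) : exists d,
    e \in [set e in rim v (depth v p) | w \in e] -> P e d.
  have [|_] := boolP (e \in _); last by exists set0.
  by rewrite in_set => /andP[er we]; have [d H] := quad_across_rim vw ep er we; exists d.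
rewrite -[X in (X <= _)%N](card_in_imset (f := f)).
  apply/subset_leq_card/subsetP => d /imsetP[e /fP[q [z [dS d4 pd _ _]]] ->].
  by rewrite in_set dS d4 pd.
move=> e e' eR e'R ff.
have [q [z [dS d4 pd qd [ee eq]]]] := fP e eR.
have [q' [z' [_ _ _ + [ee' eq']]]] := fP e' e'R.
rewrite -ff => q'd; rewrite ee ee'; congr [set w; _].
apply/eqP/negPn/negP => zz.
have [[a _]|[A [sA A2 _]]] := disc_cases dS; first by rewrite d4.
have distinct (x y : 'I_n) (r : corner S) : edge_of r = [set x; y] -> x != y.
  by move=> er; apply: contra_eq_neq (card_edge r) => xy; rewrite er xy setUid cards1.
have crossing (x y : 'I_n) (r : corner S) : r \in f e -> edge_of r = [set x; y] ->
    (x \in A) = (y \notin A).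
  move=> rd er; have [x' [y' [xA yA _ _]]] := edge_at sA rd.
  have xy := distinct _ _ _ er; rewrite er => E.
  have : x \in [set x'; y'] by rewrite -E !inE eqxx.
  have : y \in [set x'; y'] by rewrite -E !inE eqxx orbT.
  rewrite !in_set2 => /orP[] /eqP ey /orP[] /eqP ex; move: xy; rewrite ex ey ?eqxx //.
    by rewrite xA (negPf yA).
  by rewrite xA (negPf yA).
have rim2 (e0 : {set 'I_n}) z0 : e0 \in [set e in rim v (depth v p) | w \in e] ->
    e0 = [set w; z0] -> w != z0.
  rewrite in_set => /andP[]; rewrite in_set => /andP[]; rewrite in_set => /andP[e2 _] _ _ e0z.
  by apply: contraTneq e2 => wz0; rewrite e0z wz0 setUid cards1.
have wz := rim2 _ _ eR ee; have wz' := rim2 _ _ e'R ee'.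
have vz := distinct _ _ _ eq; have vz' := distinct _ _ _ eq'.
have cw := crossing _ _ _ pd ep; have cz := crossing _ _ _ qd eq.
have cz' := crossing _ _ _ q'd eq'.
have [vA|vA] := boolP (v \in A); last first.
  have : (#|[set w; z; z']| <= #|A|)%N.
    apply: subset_leq_card; rewrite !subUset !sub1set.
    by rewrite (negPf vA) in cw cz cz'; rewrite -[w \in A]negbK -cw -[z \in A]negbK -cz -[z' \in A]negbK -cz'.
  by rewrite A2 setUC cardsU1 cards2 wz !in_set2 negb_or !(eq_sym z') wz' zz.
have c4 : carrier (f e) = [set v; w; z; z'].
  apply/esym/eqP; rewrite eqEcard (card_tetrahedron (carrier_tetrahedron dS)).
  rewrite card_set4 /= ?inE ?negb_or ?vw ?vz ?vz' ?wz ?wz' ?zz // andbT.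
  have vc : v \in carrier (f e) by apply: (subsetP (edge_carrier pd)); rewrite ep set21.
  have wc : w \in carrier (f e) by apply: (subsetP (edge_carrier pd)); rewrite ep set22.
  have zc : z \in carrier (f e) by apply: (subsetP (edge_carrier qd)); rewrite eq set22.
  have zc' : z' \in carrier (f e) by apply: (subsetP (edge_carrier q'd)); rewrite eq' set22.
  by rewrite !subUset !sub1set vc wc zc zc'.
have : A \subset [set v].
  have [As _] := sA; apply/subsetP => u uA; have := subsetP As _ uA.
  rewrite c4 !in_setU !in_set1 -!orbA; case/or4P => // /eqP eu; rewrite eu in uA;
  by [rewrite vA uA in cw|rewrite vA uA in cz|rewrite vA uA in cz'].
by move/subset_leq_card; rewrite A2 cards1.
Qed.


(** * Summation over all layers *)

Lemma sum_card_swap (I J : finType) (F : I -> {set J}) :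
  (\sum_i #|F i| = \sum_j #|[set i | j \in F i]|)%N.
Proof.
transitivity (\sum_i \sum_(j in F i) 1)%N.
  by apply: eq_bigr => i _; rewrite sum1_card.
rewrite (exchange_big_dep xpredT) //=; apply: eq_bigr => j _.
by rewrite -sum1_card; apply: eq_bigl => i; rewrite inE.
Qed.

(** A depth is at most [#|corner S|], so pairs of a vertex and an ordinal below [N] index all layers
    by a finite type. *)
Let N := #|corner S|.+1.
Let lay (u : 'I_n * 'I_N) := layer u.1 u.2.
Let lrim (u : 'I_n * 'I_N) := rim u.1 u.2.
Let lcover (u : 'I_n * 'I_N) := cover (layer_link u.1 u.2).
Let D := [set p : corner S | [forall v in edge_of p, capped v p]].
Let quads := [set d in discs S | #|d| == 4%N].
Let tris := [set d in discs S | #|d| == 3%N].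

Let depth_ord v p : ((inord (depth v p) : 'I_N) : nat) = depth v p.
Proof. by rewrite inordK // ltnS max_card. Qed.

Let sum_layers : (#|tris| <= \sum_u #|lay u|)%N.
Proof.
rewrite sum_card_swap -sum1_card big_mkcond; apply: leq_sum => d _.
case: ifP => //; rewrite in_set card_gt0 => /andP[dS /eqP d3].
have [[v sv _]|[A [_ _]]] := disc_cases dS; last by rewrite d3.
have [p pd] : exists p, p \in d by apply/set0Pn; rewrite -card_gt0 d3.
by apply/set0Pn; exists (v, inord (depth v p)); rewrite in_set /lay /= depth_ord layer_depth.
Qed.

Let card_cover_layer v i : (#|cover (layer_link v i)| <=
  #|[set p | [&& v \in edge_of p, capped v p & depth v p == i]]|)%N.
Proof.
rewrite -(card_imset _ (@set1_inj _)).
apply: leq_trans (leq_imset_card (fun p => edge_of p :\ v) _).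
apply/subset_leq_card/subsetP => t /imsetP[w /bigcupP[s /imsetP[d dl ->]] /setD1P[wv wd] ->].
have [dS sv H] := (layerP _ _ _).1 dl.
have [p pd ep] := separates1_corner sv wd wv.
apply/imsetP; exists p; last first.
  by rewrite ep setU1K // in_set1 eq_sym.
rewrite in_set H // eqxx andbT ep set21 /=.
by apply/cappedP; exists d.
Qed.

Let sum_covers : (\sum_u #|lcover u| <= #|corner S| + #|D|)%N.
Proof.
apply: leq_trans (_ : \sum_(u : 'I_n * 'I_N) #|[set p | [&& u.1 \in edge_of p,
    capped u.1 p & depth u.1 p == u.2]]| <= _)%N.
  by apply: leq_sum => u _; exact: card_cover_layer.
rewrite sum_card_swap -[#|corner S|]sum1_card -[#|D|]sum1_card [X in (_ <= _ + X)%N]big_mkcond.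
rewrite -big_split; apply: leq_sum => p _ /=.
apply: leq_trans (_ : #|[set v in edge_of p | capped v p]| <= _)%N.
  rewrite -(card_in_imset (f := fst)).
    apply/subset_leq_card/subsetP => v /imsetP[u + ->].
    by rewrite !in_set => /and3P[-> ->].
  move=> [v i] [v' i']; rewrite !in_set /= => /and3P[_ _ /eqP h] /and3P[_ _ /eqP h'] vv.
  by rewrite vv in h *; congr (_, _); apply/val_inj; rewrite /= -h -h'.
case: ifP => [_|/negbT].
  apply: (@leq_trans #|edge_of p|); last by rewrite card_edge.
  by apply/subset_leq_card/subsetP => v; rewrite in_set => /andP[].
rewrite in_set negb_forall => /existsP[v]; rewrite negb_imply => /andP[vp vc].
have : (#|[set v in edge_of p | capped v p]| < #|edge_of p|)%N; last by rewrite card_edge.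
apply: proper_card; apply/properP; split.
  by apply/subsetP => w; rewrite in_set => /andP[].
by exists v => //; rewrite in_set vp.
Qed.

Let other_vertex v : exists ot : corner S -> 'I_n, forall p, v \in edge_of p ->
  edge_of p = [set v; ot p] /\ v != ot p.
Proof.
have /choice[ot oP] (p : corner S) : exists w, v \in edge_of p ->
    edge_of p = [set v; w] /\ v != w; last by exists ot.
have [vp|] := boolP (v \in edge_of p); last by exists v.
have : #|edge_of p :\ v| = 1%N by have := card_edge p; rewrite (cardsD1 v) vp => -[].
move=> /eqP/cards1P[w ew]; have : w \in edge_of p :\ v by rewrite ew set11.
by rewrite in_setD1 eq_sym => /andP[vw _]; exists w; rewrite -ew setD1K.
Qed.

(** Each such [p] has two rim edges at its other vertex [ot p]. At fixed depth [p] is determined by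
    [ot p], and a rim edge has two ends, so each rim edge is used at most twice. *)
Let capped_le_rim v i :
  (#|[set p in D | (v \in edge_of p) && (depth v p == i)]| <= #|rim v i|)%N.
Proof.
set P := [set p in D | _]; have [ot oP] := other_vertex v.
have PP p : p \in P -> [/\ v \in edge_of p, edge_of p = [set v; ot p], v != ot p,
    depth v p = i & capped v p && capped (ot p) p].
  rewrite in_set => /and3P[pD vp /eqP dp]; have [ep vo] := oP p vp.
  split=> //; move: pD; rewrite in_set => /forall_inP H.
  by rewrite !H // ep set22.
rewrite -(leq_pmul2r (m := 2)) // -!sum_nat_const.
apply: leq_trans (_ : \sum_(p in P) \sum_(e in rim v i | ot p \in e) 1 <= _)%N.
  apply: leq_sum => p /PP[vp ep vo dp /andP[c1 c2]].
  apply: leq_trans (rim_at vo ep c1 c2) _; rewrite dp -sum1_card.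
  by apply: eq_leq; apply: eq_bigl => e; rewrite in_set.
rewrite (exchange_big_dep (mem (rim v i))) /=; last by move=> p e _ /andP[].
apply: leq_sum => e er.
have -> : 2%N = #|e| by move: er; rewrite in_set => /andP[]; rewrite in_set => /andP[/eqP].
rewrite sum1_card -cardsE -(card_in_imset (f := ot)).
  apply/subset_leq_card/subsetP => w /imsetP[p]; rewrite in_set => /and3P[_ _ ?] -> //.
move=> p q; rewrite !in_set => /and3P[pP _ _] /and3P[qP _ _] opq.
have [vp ep _ dp _] := PP p pP; have [_ eq _ dq _] := PP q qP.
by apply: (depth_inj (v := v)) => //; [rewrite ep eq opq|rewrite dp dq].
Qed.

Let sum_rims : (2 * #|D| <= \sum_u #|lrim u|)%N.
Proof.
apply: leq_trans (_ : \sum_(u : 'I_n * 'I_N)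
    #|[set p in D | (u.1 \in edge_of p) && (depth u.1 p == u.2)]| <= _)%N; last first.
  by apply: leq_sum => u _; exact: capped_le_rim.
rewrite sum_card_swap mulnC -sum_nat_const big_mkcond; apply: leq_sum => p _.
case: ifP => // pD; rewrite -(card_edge p).
rewrite -(card_in_imset (f := fun v => (v, inord (depth v p) : 'I_N)) (D := edge_of p)); last first.
  by move=> v v' _ _ [].
apply/subset_leq_card/subsetP => u /imsetP[v vp ->].
by rewrite in_set in_set pD vp /= depth_ord eqxx.
Qed.

(** A corner capped at both ends lies on at least two quadrilaterals, and a quadrilateral has four
    corners. *)
Let capped_le_quads : (#|D| <= 2 * #|quads|)%N.
Proof.
suff : (2 * #|D| <= 4 * #|quads|)%N by lia.
have -> : (4 * #|quads| = \sum_(d in quads) \sum_(p in d) 1)%N.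
  rewrite mulnC -sum_nat_const; apply: eq_bigr => d.
  by rewrite in_set => /andP[_ /eqP d4]; rewrite sum1_card d4.
rewrite (exchange_big_dep xpredT) //= mulnC -sum_nat_const big_mkcond /=.
apply: leq_sum => p _; case: ifP => // pD.
have [v vp] : exists v, v \in edge_of p by apply/set0Pn; rewrite -card_gt0 card_edge.
have [ot oP] := other_vertex v; have [ep vo] := oP p vp.
move: pD; rewrite in_set => /forall_inP H.
apply: leq_trans (rim_at vo ep (H v vp) _) _; first by apply: H; rewrite ep set22.
apply: leq_trans (rim_at_le_quads vo ep) _; rewrite -sum1_card.
by apply: eq_leq; apply: eq_bigl => d; rewrite !in_set andbA.
Qed.

Lemma normal_surface_bound : manifold3 (realization (R := R) K) ->
  (0 < #|corner S|)%N -> (12 + 3 * #|tris| <= 6 * #|corner S| + 8 * #|quads|)%N.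
Proof.
move=> Kman V0.
have local u : (12 * (lay u != set0) + 3 * #|lay u| + #|lrim u| <= 6 * #|lcover u|)%N.
  have [l0|ln0] := eqVneq (lay u) set0; last by rewrite muln1; exact: layer_bound.
  rewrite l0 cards0 /lrim (_ : rim _ _ = set0) ?cards0 //.
  apply/setP => e; rewrite in_set0 in_set; apply/negP => /andP[].
  rewrite in_set => /andP[_ /exists_inP[t /imsetP[d]]].
  by rewrite -/(lay u) l0 in_set0.
have [t0|tn0] := eqVneq #|tris| 0%N; last first.
  have [u un0] : exists u, lay u != set0.
    have : (0 < \sum_u #|lay u|)%N by apply: leq_trans sum_layers; rewrite lt0n.
    rewrite lt0n sum_nat_eq0 negb_forall => /existsP[u]; rewrite negb_imply /=.
    by rewrite cards_eq0; exists u.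
  have : (\sum_u (12 * (lay u != set0) + 3 * #|lay u| + #|lrim u|) <=
      \sum_u 6 * #|lcover u|)%N by apply: leq_sum => u' _; exact: local.
  have dist k (F : 'I_n * 'I_N -> nat) : (\sum_u k * F u = k * \sum_u F u)%N.
    by rewrite big_distrr.
  rewrite (big_split _ _ _ (fun u => 12 * (lay u != set0) + 3 * #|lay u|)%N).
  rewrite (big_split _ _ _ (fun u => 12 * (lay u != set0))%N) /= !dist (bigD1 u) //= un0.
  move: (\sum_(i | i != u) _)%N => z.
  have arith (t l c k d r q : nat) : (t <= l -> c <= k + d -> 2 * d <= r ->
      d <= 2 * q -> 12 * (true + z) + 3 * l + r <= 6 * c -> 12 + 3 * t <= 6 * k + 8 * q)%N by lia.
  exact: arith sum_layers sum_covers sum_rims capped_le_quads.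
(* Without triangles no layer supplies the 12. The disc at any corner is then a quadrilateral, and
   its four corners make [6 * #|corner S|] at least 24. *)
have [p _] : exists p : corner S, true by move: V0; rewrite -cardsT card_gt0 => /set0Pn[p _]; exists p.
case: (Ktri) => _ /(_ _ (edge_in_complex p))[s sT ps] _ _.
have [d [dS pd _]] := disc_at sT ps.
have d4 : #|d| = 4%N.
  have [[v _ d3]|[A [_ _ //]]] := disc_cases dS.
  by move/eqP: t0; rewrite cards_eq0 => /eqP/setP/(_ d); rewrite !in_set dS d3 eqxx.
have q1 : (0 < #|quads|)%N by rewrite card_gt0; apply/set0Pn; exists d; rewrite in_set dS d4.
have := max_card (mem d); rewrite d4 t0; lia.
Qed.

Lemma card_discs : (#|discs S| = #|tris| + #|quads|)%N.
Proof.
have -> : quads = discs S :\: tris.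
  apply/setP => d; rewrite in_setD !in_set.
  case: (boolP (d \in discs S)) => //= dS.
  by have [[v _ ->]|[A [_ _ ->]]] := disc_cases dS.
rewrite -(cardsID tris (discs S)) (setIidPr _) //.
by apply/subsetP => d /setIdP[].
Qed.

Lemma double_card_arcs_quads : (2 * #|arcs S| = 3 * #|tris| + 4 * #|quads|)%N.
Proof.
rewrite double_card_arcs.
transitivity (\sum_(d in discs S) (3 + (#|d| == 4)))%N.
  by apply: eq_bigr => d /disc_cases[[v _ ->]|[A [_ _ ->]]].
rewrite big_split /= sum_nat_const card_discs.
have -> : (\sum_(d in discs S) (#|d| == 4) = #|quads|)%N.
  rewrite -sum1_card [RHS](eq_bigl (fun d => (d \in discs S) && (#|d| == 4%N))).
    by rewrite big_mkcondr /=; apply: eq_bigr => d _; case: (_ == _).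
  by move=> d; rewrite in_set.
by rewrite mulnC mulnDr -addnA -mulSnr.
Qed.

End NormalDiscs.

Theorem corollary13 (R : realType) (n : nat) (K : {set {set 'I_n}})
    (S : normal_cells R n) :
  simplicial_triangulation K ->
  manifold3 (realization (R := R) K) ->
  orientable_triangulation K ->
  normal_surface K S ->
  closed_surface S -> connected_surface S -> orientable_surface S ->
  6 * genus S <= 7 * (num_quads S)%:R.
Proof.
move=> Ktri Kman _ Snorm Sclosed [V0 _] _.
have bound := normal_surface_bound Ktri Snorm Sclosed Kman V0.
have nd := card_discs Snorm; have na := double_card_arcs_quads Snorm Sclosed.
rewrite /genus /euler_char /num_quads.
move: bound nd na; set t := #|[set d in discs S | #|d| == 3%N]|.
set q := #|[set d in discs S | #|d| == 4%N]| => bound nd na.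
(* With [2 * #|arcs S| = 3 t + 4 q] and [#|discs S| = t + q], twice the genus is
   [2 - #|corner S| + t / 2 + q]. Three times this is at most [7 q] exactly when
   [12 + 3 t <= 6 * #|corner S| + 8 q]. *)
have : 3 * (2 - (#|corner S|%:Z - #|arcs S|%:Z + #|discs S|%:Z)) <= 7 * q%:Z by lia.
rewrite -(ler_int rat) !intrM => h.
by rewrite mulrA mulrAC; lra.
Qed.
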